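(* Let $(M,\Omega,\Gamma,Z,h)$ be a Joyce structure over a complex manifold $M$, let $\mathcal{A}=h+\epsilon^{-1}v$ be its associated formal relative connection and let $\mathcal{A}^{\mathrm{st}}=\mathcal{H}+\epsilon^{-1}v$, where $\mathcal{H}$ is the Ehresmann connection on $\pi:TM\to M$ induced by the flat linear connection $\nabla$ determined by $\Gamma$. Then there exists a unique $\dot g=\sum_{k\ge 1}\dot g_k\epsilon^k\in \mathrm{Lie}(\widehat{\mathcal G})=\epsilon\cdot\Gamma(TM,V_\pi)[[\epsilon]]$ such that $$e^{\mathcal{L}_{\dot g}}\mathcal{A}^{\mathrm{st}}=\mathcal{A}\qquad\text{and}\qquad \dot g|_{M}=0,$$ where $M\subset TM$ is the zero section.
   Context: All objects and morphisms are holomorphic. $\pi:TM\to M$ is the tangent bundle projection and $V_\pi=\mathrm{Ker}(\pi_* )\subset T(TM)$ the vertical bundle. $v:\pi^*(TM)\to V_\pi$ is the canonical identification: in coordinates $(Z^i,\theta^i)$ on $TM$ induced by coordinates $(Z^i)$ on $M$, $v_{\partial_{Z^i}}=\partial_{\theta^i}$. An (Ehresmann) connection on $\pi$ is a bundle map $h:\pi^*(TM)\to T(TM)$ with $\pi_*\circ h=\mathrm{Id}$; for a local vector field $X$ on $M$, $h_X=h(X)$ denotes the lifted vector field on $TM$. It is flat if its image distribution is involutive, equivalently $[h_X,h_Y]=h_{[X,Y]}$ for all local vector fields $X,Y$ on $M$. For a holomorphic symplectic form $\Omega$ on $M$, $\Omega^v$ is the fibrewise symplectic form on $V_\pi$ with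 $\Omega^v(v_X,v_Y)=\Omega(X,Y)$; a connection is symplectic if its parallel transport maps between open subsets of fibres of $\pi$ preserve $\Omega^v$. A pre-Joyce structure on $(M,\Omega)$ is a connection $h$ on $\pi$ such that $\mathcal{A}^\epsilon=h+\epsilon^{-1}v$ is flat and symplectic for each $\epsilon\in\mathbb{C}^*$. A period structure on $M$ is a pair $(\Gamma,Z)$ where $\Gamma\to M$ is a bundle of full lattices in $TM$ ($\Gamma_p\subset T_pM$ a discrete finitely generated subgroup with $\Gamma_p\otimes_{\mathbb Z}\mathbb{C}=T_pM$), and $Z$ is a holomorphic vector field on $M$ with $\nabla Z=\mathrm{Id}_{TM}$, where $\nabla$ is the flat linear connection on $TM$ for which local sections of $\Gamma$ are flat. A Joyce structure $(M,\Omega,\Gamma,Z,h)$ is a pre-Joyce structure $(\Omega,h)$ together with a period structure $(\Gamma,Z)$ such that: (J1) $(2\pi\mathrm{i})^{-1}\Omega^{-1}$ takes integral values on the dual lattices $\Gamma^*\subset T^*M$; (J2) $h$ is invariant under translations by $(2\pi \mathrm{i})\Gamma\subset TM$; (J3) if $E$ is the $\nabla$-horizontal lift of $Z$ to $TM$, then $h([Z,X])=[E,h(X)]$ for every vector field $X$ on $M$; (J4) $h$ is invariant under the involution of $TM$ acting by $-1$ on the fibres of $\pi$. Formal objects: $\epsilon$ is a formal variable. $\mathrm{Lie}(\widehat{\mathcal G})$ is the set of series $\dot g=\sum_{k\ge1}\dot g_k\epsilon^k$ with each $\dot g_k$ a global vertical vector field on $TM$ (section of $V_\pi\to TM$). For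 a formal relative connection $\mathcal{B}=\epsilon^{-1}v+h'$ (with $h'$ a connection on $\pi$), $e^{\mathcal L_{\dot g}}\mathcal B$ is defined by $(e^{\mathcal{L}_{\dot g}}\mathcal{B})_X=\sum_{k\ge0}\frac{1}{k!}\mathcal{L}_{\dot g}^k(\mathcal{B}_X)$ for local vector fields $X$ on $M$, with $\mathcal{L}_{\dot g}Y=[\dot g,Y]=\sum_k\epsilon^k[\dot g_k,Y]$, extended linearly over $\mathbb{C}[[\epsilon]]$; equality of connections means equality of formal (Laurent) series in $\epsilon$. *)

(* Defs.v *)
From HB Require Import structures.
From mathcomp Require Import all_boot all_order all_algebra.
From mathcomp Require Import complex.
From mathcomp Require Import all_classical all_reals all_analysis.

Set Implicit Arguments.
Unset Strict Implicit.
Unset Printing Implicit Defensive.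

Import Order.TTheory GRing.Theory Num.Theory.
Import numFieldNormedType.Exports.

Local Open Scope classical_set_scope.
Local Open Scope ring_scope.

(* The field of complex numbers, kept as a constant so that its topology (from
   numFieldNormedType) is found; differentiability over it is complex
   differentiability. *)
Definition Cplx (R : realType) : numClosedFieldType := R[i].
Definition of_real (R : realType) (x : R) : Cplx R := x%:C%C.

Section Calculus.
Context {R : realType} {V W : normedModType (Cplx R)}.

(* Holomorphic maps on an open set U are smooth maps with complex-linear
   differential: complex differentiable on U, together with all their iterated
   directional derivatives. *)
Fixpoint holomorphic_order (k : nat) (U : set V) (f : V -> W) : Prop :=
  if k is k'.+1 then
    (forall x, U x -> differentiable f x) /\
    (forall v : V, holomorphic_order k' U (fun x => 'D_v f x))
  else True.

Definition holomorphic (U : set V) (f : V -> W) : Prop :=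
  forall k, holomorphic_order k U f.

Definition lie_bracket (X Y : V -> V) : V -> V :=
  fun p => 'D_(X p) Y p - 'D_(Y p) X p.

(* Derivative, with respect to real time, of a path in a complex space. *)
Definition path_derive (c : R -> V) (t : R) (v : V) : Prop :=
  (fun s : R => of_real s^-1 *: (c (t + s) - c t)) @ 0^' --> v.

End Calculus.

Record complex_manifold (R : realType) (n : nat) := ComplexManifold {
  carrier :> topologicalType;
  carrier_hausdorff : hausdorff_space carrier;
  carrier_second_countable : @second_countable carrier;
  chart_index : Type;
  dom : chart_index -> set carrier;
  chart : chart_index -> carrier -> 'rV[Cplx R]_n;
  chart_inv : chart_index -> 'rV[Cplx R]_n -> carrier;
  dom_open : forall i, open (dom i);
  dom_cover : forall p, exists i, dom i p;
  chartK : forall i p, dom i p -> chart_inv i (chart i p) = p;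
  img_open : forall i, open (chart i @` dom i);
  chart_continuous : forall i p, dom i p -> {for p, continuous (chart i)};
  chart_inv_continuous : forall i z,
    (chart i @` dom i) z -> {for z, continuous (chart_inv i)};
  transition_holomorphic : forall i j,
    holomorphic (chart i @` (dom i `&` dom j)) (chart j \o chart_inv i)
}.

(* A chart i of M identifies dom i with the open set img i, and identifies
   pi^-1 (dom i) in TM with the open set timg i of pairs (z, theta).  Tensors on
   M or TM are families of coordinate expressions, one for each chart, which
   correspond under the changes of coordinates tau i j or Ttau i j; a coordinate
   expression is a total function whose values outside img i or timg i are
   irrelevant. *)
Section Geometry.
Context {R : realType} {n : nat} (M : complex_manifold R n).
Local Notation C := (Cplx R).
Local Notation E := ('rV[C]_n).
Local Notation TE := (E * E)%type.

Definition img (i : chart_index M) : set E := chart i @` dom i.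
Definition overlap (i j : chart_index M) : set E :=
  chart i @` (dom i `&` dom j).
Definition tau (i j : chart_index M) : E -> E := chart j \o chart_inv i.
Definition timg (i : chart_index M) : set TE := [set p | img i p.1].
Definition Ttau (i j : chart_index M) : TE -> TE :=
  fun p => (tau i j p.1, 'D_(p.2) (tau i j) p.1).

(* A local vector field on M is given, in the chart i, by X : E -> E on W. *)
Definition local_field (i : chart_index M) (W : set E) (X : E -> E) : Prop :=
  [/\ open W, W `<=` img i & holomorphic W X].

Definition vector_field (X : chart_index M -> E -> E) : Prop :=
  (forall i, holomorphic (img i) (X i)) /\
  (forall i j z, overlap i j z -> 'D_(X i z) (tau i j) z = X j (tau i j z)).

(* Global sections of V_pi over TM. *)
Definition vertical_field (Y : chart_index M -> TE -> TE) : Prop :=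
  [/\ forall i, holomorphic (timg i) (Y i),
      forall i p, timg i p -> (Y i p).1 = 0 &
      forall i j p, overlap i j p.1 ->
        'D_(Y i p) (Ttau i j) p = Y j (Ttau i j p)].

(* h i x p is the lift to p of the tangent vector x at p.1. *)
Record connection := Connection {
  hlift :> chart_index M -> E -> TE -> TE;
  hlift_linear : forall i p, timg i p -> forall a x y,
    hlift i (a *: x + y) p = a *: hlift i x p + hlift i y p;
  hlift_proj : forall i p, timg i p -> forall x, (hlift i x p).1 = x;
  hlift_holomorphic : forall i x, holomorphic (timg i) (hlift i x);
  hlift_compat : forall i j p x, overlap i j p.1 ->
    'D_(hlift i x p) (Ttau i j) p = hlift j ('D_x (tau i j) p.1) (Ttau i j p)
}.

Definition vlift (i : chart_index M) (x : E) (p : TE) : TE := (0, x).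

Definition lift_field (A : chart_index M -> E -> TE -> TE) (i : chart_index M)
  (X : E -> E) : TE -> TE := fun p => A i (X p.1) p.

Definition flat (A : chart_index M -> E -> TE -> TE) : Prop :=
  forall i W X Y, local_field i W X -> local_field i W Y ->
  forall p, W p.1 ->
    lie_bracket (lift_field A i X) (lift_field A i Y) p =
    lift_field A i (lie_bracket X Y) p.

Definition bil (B : 'M[C]_n) (x y : E) : C := (x *m B *m y^T) 0 0.

Record symplectic_form := SymplecticForm {
  omega :> chart_index M -> E -> 'M[C]_n;
  omega_holomorphic : forall i, holomorphic (img i) (omega i);
  omega_alternating : forall i z, img i z -> forall x, bil (omega i z) x x = 0;
  omega_nondegenerate : forall i z, img i z -> omega i z \in unitmx;
  omega_compat : forall i j z, overlap i j z -> forall x y,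
    bil (omega j (tau i j z)) ('D_x (tau i j) z) ('D_y (tau i j) z) =
    bil (omega i z) x y;
  omega_closed : forall i z, img i z -> forall x y w,
    bil ('D_x (omega i) z) y w + bil ('D_y (omega i) z) w x +
    bil ('D_w (omega i) z) x y = 0
}.

(* th1 is the parallel transport of th0 for A along the path c with
   velocity c'. *)
Definition parallel_transport (A : chart_index M -> E -> TE -> TE)
  (i : chart_index M) (c c' : R -> E) (th0 th1 : E) : Prop :=
  exists th : R -> E, [/\ th 0 = th0, th 1 = th1 &
    forall t, t \in `[0, 1]%R ->
      path_derive th t (A i (c' t) (c t, th t)).2].

(* Parallel transport along a general path is a composition of parallel
   transports along paths contained in the domain of a chart.  The restriction
   of Omega^v to the fibre over z is the constant form omega i z. *)
Definition symplectic_connection (Om : symplectic_form)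
  (A : chart_index M -> E -> TE -> TE) : Prop :=
  forall i (c c' : R -> E),
    (forall t, t \in `[0, 1]%R -> img i (c t) /\ path_derive c t (c' t)) ->
    {within [set` `[0, 1]%R], continuous c'} ->
  forall (W : set E) (P : E -> E), open W -> holomorphic W P ->
    (forall th, W th -> parallel_transport A i c c' th (P th)) ->
  forall th, W th -> forall x y,
    bil (Om i (c 1)) ('D_x P th) ('D_y P th) = bil (Om i (c 0)) x y.

Definition pencil (h : connection) (eps : C) (i : chart_index M)
  (x : E) (p : TE) : TE := h i x p + eps^-1 *: vlift i x p.

Definition pre_joyce (Om : symplectic_form) (h : connection) : Prop :=
  forall eps : C, eps != 0 ->
    flat (pencil h eps) /\ symplectic_connection Om (pencil h eps).

(* A linear connection on TM is an Ehresmann connection whose vertical part is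
   linear in the fibre coordinate; covariant i x Y z is then the derivative at z
   of Y along x. *)
Definition linear_connection (H : connection) : Prop :=
  forall i z, img i z -> forall x a th th',
    (H i x (z, a *: th + th')).2 = a *: (H i x (z, th)).2 + (H i x (z, th')).2.

Definition covariant (H : connection) (i : chart_index M) (x : E) (Y : E -> E)
  (z : E) : E := 'D_x Y z - (H i x (z, Y z)).2.

Definition Zspan (A : 'M[C]_n) : set E :=
  [set x | exists c : 'rV[int]_n, x = map_mx intr c *m A].

Definition lattice_section (Gam : chart_index M -> E -> set E)
  (i : chart_index M) (W : set E) (s : E -> E) : Prop :=
  local_field i W s /\ (forall z, W z -> Gam i z (s z)).

Record period_structure := PeriodStructure {
  lattice : chart_index M -> E -> set E;
  lattice_compat : forall i j z x, overlap i j z ->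
    lattice i z x -> lattice j (tau i j z) ('D_x (tau i j) z);
  (* Locally, there is a holomorphic frame of TM (the rows of A) which is a
     basis over the integers of the lattices; this is the condition that the
     fibres tensored with C are the tangent spaces. *)
  lattice_frame : forall i z0, img i z0 -> exists W (A : E -> 'M[C]_n),
    [/\ open W, W z0, W `<=` img i, holomorphic W A &
        forall z, W z -> A z \in unitmx /\ lattice i z = Zspan (A z)];
  (* nabla is uniquely determined by the lattices. *)
  nabla : connection;
  nabla_linear : linear_connection nabla;
  nabla_flat : flat nabla;
  nabla_lattice : forall i W s, lattice_section lattice i W s ->
    forall z x, W z -> covariant nabla i x s z = 0;
  Zfield : chart_index M -> E -> E;
  Zfield_vector_field : vector_field Zfield;
  nabla_Zfield : forall i z x, img i z -> covariant nabla i x (Zfield i) z = x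
}.

(* Covectors are row vectors, paired with vectors by the dot product. *)
Definition dual_lattice (P : period_structure) (i : chart_index M) (z : E) :
  set E :=
  [set xi | forall x, lattice P i z x ->
            exists k : int, (x *m xi^T) 0 0 = k%:~R].

Definition two_pi_i : C := of_real (2 * pi) * 'i.

(* h is preserved by a map T of TM covering the identity of M. *)
Definition invariant_under (h : connection) (i : chart_index M) (W : set E)
  (T : TE -> TE) : Prop :=
  forall p x, W p.1 -> 'D_(h i x p) T p = h i x (T p).

Record joyce_structure := JoyceStructure {
  jomega : symplectic_form;
  jperiod : period_structure;
  jconn : connection;
  joyce_pre : pre_joyce jomega jconn;
  (* The inverse of Omega has matrix invmx (jomega i z), up to a sign. *)
  joyce_integral : forall i z xi eta, img i z ->
    dual_lattice jperiod i z xi -> dual_lattice jperiod i z eta ->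
    exists k : int, two_pi_i^-1 * bil (invmx (jomega i z)) xi eta = k%:~R;
  joyce_periodic : forall i W s, lattice_section (lattice jperiod) i W s ->
    invariant_under jconn i W (fun p => (p.1, p.2 + two_pi_i *: s p.1));
  joyce_homogeneous : forall i W X, local_field i W X -> forall p, W p.1 ->
    lift_field jconn i (lie_bracket (Zfield jperiod i) X) p =
    lie_bracket (lift_field (nabla jperiod) i (Zfield jperiod i))
                (lift_field jconn i X) p;
  joyce_odd : forall i,
    invariant_under jconn i (img i) (fun p => (p.1, - p.2))
}.

(* b : nat -> TE -> TE stands for the Laurent series
   eps^-1 * \sum_(m >= 0) b m * eps^m of vector fields. *)
Definition formal_connection (h : connection) (i : chart_index M) (X : E -> E) :
  nat -> TE -> TE :=
  fun m => if m is m'.+1 then (if m' is 0 then lift_field h i X else 0)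
           else lift_field vlift i X.

End Geometry.

Section FormalGauge.
Context {R : realType} {V : normedModType (Cplx R)}.

(* g stands for \sum_(k >= 1) g k * eps^k; g 0 is irrelevant. *)
Definition ad_series (g b : nat -> V -> V) : nat -> V -> V :=
  fun m p => \sum_(1 <= k < m.+1) lie_bracket (g k) (b (m - k)%N) p.

(* The coefficient of order m in \sum_k 1/k! (ad_series g)^k b: the terms with
   k > m vanish because g starts in order 1. *)
Definition exp_ad_series (g b : nat -> V -> V) : nat -> V -> V :=
  fun m p => \sum_(k < m.+1) (k`!%:R)^-1 *: iter k (ad_series g) b m p.

End FormalGauge.

Section Gauge.
Context {R : realType} {n : nat} (M : complex_manifold R n).
Local Notation TE := ('rV[Cplx R]_n * 'rV[Cplx R]_n)%type.

Definition gauge_algebra (g : nat -> chart_index M -> TE -> TE) : Prop :=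
  forall k, (0 < k)%N -> vertical_field (g k).

Definition gauge_relates (g : nat -> chart_index M -> TE -> TE)
  (h0 h1 : connection M) : Prop :=
  forall i W X, local_field i W X -> forall m p, W p.1 ->
    exp_ad_series (fun k => g k i) (formal_connection h0 i X) m p =
    formal_connection h1 i X m p.

Definition vanishes_on_zero_section (g : nat -> chart_index M -> TE -> TE) :
  Prop :=
  forall k i z, (0 < k)%N -> img i z -> g k i (z, 0) = 0.

Definition gauge_eq (g g' : nat -> chart_index M -> TE -> TE) : Prop :=
  forall k i p, (0 < k)%N -> timg i p -> g k i p = g' k i p.

End Gauge.

(* Main.v *)
(* Write A = h + eps^-1 v and A0 = H + eps^-1 v, H being the connection induced
   by nabla.  Both are flat as formal series in eps: for A this is the flatness of
   the pencil at eps = 1 and eps = -1, for A0 it says that nabla is flat and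
   torsion free, the latter because nabla Z = Id.  The series g is built degree by
   degree.  If e^(ad g) A0 agrees with A up to order eps^(k-1), their difference
   in order eps^k is a vertical 1-form R along the fibres; since e^(ad g) is an
   automorphism of formal Lie series, e^(ad g) A0 is flat too, and comparing the
   two flatness equations in order eps^(k-1) shows that R is closed on each fibre.
   The fibres are vector spaces, so R = d f for a unique vertical f vanishing on
   the zero section, given by integrating R along rays; adding eps^(k+1) f to g
   corrects order eps^k because [f, v_x] = - df(v_x).  The construction by rays
   commutes with the linear changes of fibre coordinates, so f is global.
   Uniqueness: the first difference of two solutions g has zero derivative along
   the fibres and vanishes on the zero section. *)
Require Import Defs.
From HB Require Import structures.
From mathcomp Require Import all_boot all_order all_algebra.
From mathcomp Require Import complex ring.
From mathcomp Require Import all_classical all_reals all_analysis.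
Set Implicit Arguments.
Unset Strict Implicit.
Unset Printing Implicit Defensive.
Import Order.TTheory GRing.Theory Num.Theory.
Import numFieldNormedType.Exports.
Local Open Scope classical_set_scope.
Local Open Scope ring_scope.

(** * Mean value inequality and symmetry of second derivatives *)

(** In a chart it suffices to follow the constant frame [ebase l]: coordinate fields commute, so
    flatness becomes the vanishing of brackets of series, with no term for [X, Y]. Arbitrary local
    fields and changes of chart are recovered because vertical fields annihilate functions pulled
    back from M, so that e^(ad g) is linear over them. The algebra of exponentials needs a genuine
    Lie algebra, while a vector field is a total function of which only the values on an open set
    matter; extension by 0 reconciles the two. The analytic obstacle is that holomorphy means
    complex differentiability of all iterated directional derivatives, whereas the integral and the
    mean value theorem at hand concern functions of a real variable. Symmetry of second derivatives,
    on which the Jacobi identity rests, and holomorphy of the ray integrals are therefore obtained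
    by restricting to real segments and treating real and imaginary parts separately. *)

Section EpsilonDifferentiable.
Context {K : numFieldType} {V W : normedModType K}.

Lemma differentiable_eps (f : V -> W) (p : V) : differentiable f p ->
  forall e, 0 < e -> \forall x \near (0 : V),
    `|f (x + p) - f p - 'D_x f p| <= e * `|x|.
Proof.
move=> df e e0; move: (df) => /diff_locally /eqaddoP /(_ e e0).
apply: filter_app; near=> x; rewrite deriveE//; congr (_ <= _); congr (`| _ |).
by rewrite -[in LHS]/(_ - _) opprD addrA.
Unshelve. all: by end_near. Qed.

Lemma derive_dirD (f : V -> W) p u v : differentiable f p ->
  'D_(u + v) f p = 'D_u f p + 'D_v f p.
Proof. by move=> df; rewrite !deriveE// linearD. Qed.

Lemma derive_dirZ (f : V -> W) p a u : differentiable f p ->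
  'D_(a *: u) f p = a *: 'D_u f p.
Proof. by move=> df; rewrite !deriveE// linearZ. Qed.

(** Serves where the differential is known only as a candidate formula: for functions agreeing near
    a point, and for integrals depending on a parameter. *)
Lemma eps_diff (f : V -> W) (df : {linear V -> W}) (p : V) : continuous df ->
  (forall e, 0 < e -> \forall x \near (0 : V),
    `|f (x + p) - f p - df x| <= e * `|x|) ->
  differentiable f p /\ 'd f p = df :> (V -> W).
Proof.
move=> dfc H.
have Hl : f \o shift p = cst (f p) + df +o_ (0 : V) id.
  apply/eqaddoP => e e0; have := H e e0.
  apply: filter_app; near=> x; congr (_ <= _); congr (`| _ |).
  by rewrite -[in RHS]/(_ - _) opprD addrA.
have E := diff_unique dfc Hl; split=> //.
by apply/diff_locallyP; rewrite E; split.
Unshelve. all: by end_near. Qed.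

End EpsilonDifferentiable.

Lemma derive_comp (K : numFieldType) (U V W : normedModType K)
  (g : U -> V) (f : V -> W) (x v : U) :
  differentiable g x -> differentiable f (g x) ->
  'D_v (f \o g) x = 'D_('D_v g x) f (g x).
Proof.
move=> dg df; rewrite !deriveE//; last exact: differentiable_comp.
by rewrite diff_comp.
Qed.

Lemma is_derive_shiftr (K : numFieldType) (V W : normedModType K)
  (f : V -> W) (x v a : V) : differentiable f (x + a) ->
  is_derive x v (fun y => f (y + a)) ('D_v f (x + a)).
Proof.
move=> df; have dg : differentiable (fun y => y + a) x.
  by apply: differentiableD => //; exact: differentiable_cst.
apply: DeriveDef; first exact/diff_derivable/(differentiable_comp dg df).
rewrite (derive_comp _ dg df); congr ('D__ f _).
by rewrite deriveD// derive_id derive_cst addr0.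
Qed.

Section ComplexMeanValue.
Context {R : realType}.
Local Notation C := (Cplx R).

Lemma of_realV (x : R) : of_real x^-1 = (of_real x)^-1.
Proof. by rewrite /of_real fmorphV. Qed.

Lemma of_realD (x y : R) : of_real (x + y) = of_real x + of_real y.
Proof. by rewrite /of_real rmorphD. Qed.

Lemma of_realM (x y : R) : of_real (x * y) = of_real x * of_real y.
Proof. by rewrite /of_real rmorphM. Qed.

Lemma of_realX (x : R) k : of_real (x ^+ k) = of_real x ^+ k.
Proof. by rewrite /of_real rmorphXn. Qed.

Lemma of_real0 : of_real (0 : R) = 0. Proof. by []. Qed.
Lemma of_real1 : of_real (1 : R) = 1. Proof. by []. Qed.

Lemma of_real_eq0 (x : R) : (of_real x == 0) = (x == 0).
Proof. by rewrite -of_real0 (inj_eq (@complexI R)). Qed.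

Lemma of_real_lt (x y : R) : (of_real x < of_real y) = (x < y).
Proof. exact: ltcR. Qed.

Lemma of_real_le (x y : R) : (of_real x <= of_real y) = (x <= y).
Proof. exact: lecR. Qed.

Lemma norm_of_real (x : R) : `|of_real x| = of_real `|x|.
Proof. by rewrite normc_def /= expr0n addr0 sqrtr_sqr. Qed.

Definition re (z : C) : R := @complex.Re R z.

Lemma re_of_realM (x : R) (z : C) : re (of_real x * z) = x * re z.
Proof. by case: z => a b; rewrite /re /= mul0r subr0. Qed.

Lemma gt0_of_real (e : C) : 0 < e -> e = of_real (re e).
Proof. by move=> /ltW /ger0_real /RRe_real. Qed.

Lemma reD (x y : C) : re (x + y) = re x + re y.
Proof. by case: x y => ? ? [? ?]. Qed.

Lemma reB (x y : C) : re (x - y) = re x - re y.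
Proof. by case: x y => ? ? [? ?]. Qed.

Lemma re_le (z : C) (e : R) : `|z| <= of_real e -> `|re z| <= e.
Proof. by move=> /(le_trans (normc_ge_Re z)); rewrite lecR. Qed.

Lemma continuous_re : continuous re.
Proof.
move=> z; apply/(cvgrPdist_le (FF := nbhs_filter z)) => e e0.
have e0' : 0 < of_real e by rewrite -of_real0 of_real_lt.
near=> x; rewrite -reB; apply: re_le.
by near: x; apply: cvgr_dist_le.
Unshelve. all: by end_near. Qed.

Lemma continuous_of_real : continuous (@of_real R : R -> C).
Proof.
move=> z; apply/cvgrPdist_le => e e0.
have ee := gt0_of_real e0.
have e0' : 0 < re e by rewrite -of_real_lt -ee.
near=> x; rewrite -[_ - _](rmorphB (real_complex R)) -/(of_real _) norm_of_real ee of_real_le.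
by near: x; apply: cvgr_dist_le.
Unshelve. all: by end_near. Qed.

Lemma of_real_dnbhs : (@of_real R : R -> C) @ 0^' --> (0 : C)^'.
Proof.
move=> A A0; have {A0} A0 : nbhs (0 : C) (fun y => y != 0 -> A y) by [].
have := @continuous_of_real 0 _ A0.
rewrite [nbhs (_ @ _) _]/= nbhs_filterE.
apply: (@filterS R (nbhs (0 : R)) (nbhs_filter 0)) => x Ax x0; apply: Ax.
by rewrite of_real_eq0.
Qed.

(** A complex difference quotient converges in particular along real increments. The factor [u]
    covers the real part ([u] = 1) and the imaginary part ([u] = [- 'i]) at once. *)
Lemma is_derive_re (V : normedModType C) (f : V -> C) (u : C) (q w : V) (t : R) :
  derivable f (q + of_real t *: w) w ->
  is_derive t 1 (fun t => re (u * f (q + of_real t *: w)))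
    (re (u * 'D_w f (q + of_real t *: w))).
Proof.
move=> df.
suff H : (fun s : R => s^-1 *: (((fun t => re (u * f (q + of_real t *: w))) \o shift t)
    (s *: 1) - re (u * f (q + of_real t *: w)))) @ 0^' -->
    re (u * 'D_w f (q + of_real t *: w)).
  split; first by apply/cvg_ex; eexists; exact: H.
  by apply: cvg_lim H.
pose g (s : C) := re (u * (s^-1 *: ((f \o shift (q + of_real t *: w)) (s *: w) -
   f (q + of_real t *: w)))).
have -> : (fun s : R => s^-1 *: (((fun t => re (u * f (q + of_real t *: w))) \o shift t)
    (s *: 1) - re (u * f (q + of_real t *: w)))) = g \o (@of_real R).
  apply/funext => s; rewrite /g /= [s *: 1]mulr1 of_realD scalerDl.
  rewrite -reB -mulrBr -[LHS]re_of_realM mulrCA of_realV.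
  by congr (re (u * (_ * (f _ - _)))); rewrite addrCA.
apply: cvg_comp; first exact: of_real_dnbhs.
rewrite /g; apply: (cvg_comp _ re); last exact: continuous_re.
by apply: cvgM; [exact: cvg_cst|exact: df].
Qed.

End ComplexMeanValue.

Section MeanValueInequality.
Context {R : realType}.
Local Notation C := (Cplx R).

Lemma norm_le_re (z : C) :
  `|z| <= of_real `|re z| + of_real `|re (- 'i * z)|.
Proof.
have {1}-> : z = of_real (re z) + 'i * of_real (re (- 'i * z)).
  rewrite [LHS](complexE (z : R[i])) -complexiE; congr (_ + _ * of_real _).
  by case: z => a b; rewrite /re /=; simpc.
apply: le_trans (ler_normD _ _) _.
by rewrite normrM normCi mul1r !norm_of_real.
Qed.

Context {V : normedModType C}.

(* The factor 2 comes from applying the real mean value theorem separately to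
   the real and to the imaginary part. *)
Lemma mean_value_inequality (f : V -> C) (q w : V) (l : C) (e : R) :
  (forall t : R, t \in `[0, 1] -> derivable f (q + of_real t *: w) w) ->
  (forall t : R, t \in `[0, 1] -> `|'D_w f (q + of_real t *: w) - l| <= of_real e) ->
  `|f (q + w) - f q - l| <= of_real (2 * e).
Proof.
move=> df fl.
have H (u : C) : `|u| = 1 -> `|re (u * (f (q + w) - f q - l))| <= e.
  move=> u1.
  pose F t := re (u * f (q + of_real t *: w)).
  pose dF t := re (u * 'D_w f (q + of_real t *: w)).
  have FdF (t : R) : t \in `[0, 1] -> is_derive t 1 F (dF t).
    by move=> t01; apply: is_derive_re; exact: df.
  have F01 : {within `[0, 1], continuous F}.
    apply: derivable_within_continuous => t t01.
    by have [] := FdF _ t01.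
  have F01' (t : R) : t \in `]0, 1[ -> is_derive t 1 F (dF t).
    by move=> t01; apply: FdF; exact: subset_itv_oo_cc.
  have lt01 : 0 < 1 :> R by exact: ltr01.
  have [c c01] := MVT lt01 F01' F01.
  rewrite /F /dF.
  rewrite subr0 mulr1 of_real1 scale1r of_real0 scale0r addr0 => fE.
  rewrite mulrBr reB mulrBr reB fE -reB -mulrBr.
  by apply: re_le; rewrite normrM u1 mul1r; apply: fl; exact: subset_itv_oo_cc.
apply: le_trans (norm_le_re _) _.
have := H 1 (normr1 _); rewrite mul1r => H1.
have := H (- 'i); rewrite normrN normCi => /(_ erefl) H2.
by rewrite -of_realD of_real_le mulr_natl mulr2n lerD.
Qed.

End MeanValueInequality.

Section SymmetricSecondDerivative.
Context {R : realType}.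
Local Notation C := (Cplx R).
Context {V : normedModType C}.

Lemma ge0_of_real (e : C) : 0 <= e -> e = of_real (re e).
Proof. by move=> /ger0_real /RRe_real. Qed.

Lemma mean_value_inequalityC (f : V -> C) (q w : V) (l e : C) :
  (forall t : R, t \in `[0, 1] -> derivable f (q + of_real t *: w) w) ->
  (forall t : R, t \in `[0, 1] -> `|'D_w f (q + of_real t *: w) - l| <= e) ->
  `|f (q + w) - f q - l| <= 2 * e.
Proof.
move=> df fl.
have e0 : 0 <= e.
  by apply: le_trans (fl 0 _); rewrite ?normr_ge0// in_itv/= lexx ler01.
rewrite (ge0_of_real e0); have -> : 2 = of_real 2 :> C.
  by rewrite /of_real rmorph_nat.
rewrite -of_realM; apply: mean_value_inequality => // t t01.
by rewrite -ge0_of_real//; exact: fl.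
Qed.

Lemma near0_ex (P : C -> Prop) :
  (\forall s \near (0 : C), P s) -> exists2 s : C, s != 0 & P s.
Proof.
move=> /nbhs_ballP[d /= d0 dP]; exists (d / 2); first by rewrite gt_eqF// divr_gt0.
apply: dP; rewrite -ball_normE /ball_/= sub0r normrN gtr0_norm ?divr_gt0//.
by rewrite ltr_pdivrMr// ltr_pMr// ltr1n.
Qed.

(* The second difference on the left is symmetric in u and v. *)
Lemma second_difference (f : V -> C) (p u v : V) (e : C) : 0 < e ->
  (\forall x \near p, differentiable f x) ->
  differentiable (fun x => 'D_v f x) p ->
  \forall s \near (0 : C),
    `|f (p + s *: u + s *: v) - f (p + s *: u) - (f (p + s *: v) - f p)
      - s ^+ 2 * 'D_u (fun x => 'D_v f x) p|
    <= 4 * e * (`|u| + `|v|) * `|s| ^+ 2.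
Proof.
move=> e0 nf dh; set h := (fun x => 'D_v f x) in dh *.
have K0 : 0 < `|u| + `|v| + 1 by rewrite ltr_wpDl ?addr_ge0.
have /nbhs_ballP[d /= d0 dP] : \forall x \near (0 : V),
    differentiable f (x + p) /\ `|h (x + p) - h p - 'D_x h p| <= e * `|x|.
  near=> x; split; last by near: x; exact: differentiable_eps.
  by near: x; move: nf; rewrite (near_shift 0) /=; apply: filterS => x /=; rewrite subr0.
have {}dP x : `|x| < d ->
    differentiable f (x + p) /\ `|h (x + p) - h p - 'D_x h p| <= e * `|x|.
  by move=> xd; apply: dP; rewrite -ball_normE/= sub0r normrN.
have Hs : \forall s \near (0 : C), `|s| < d / (`|u| + `|v| + 1).
  by apply: (@nbhs0_lt _ C); exact: divr_gt0.
near=> s.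
have sd : `|s| * (`|u| + `|v|) < d.
  apply: (@le_lt_trans _ _ (`|s| * (`|u| + `|v| + 1))).
    by rewrite ler_wpM2l// lerDl.
  by rewrite -ltr_pdivlMr//; near: s.
have E1 (t : R) : t \in `[0, 1] ->
    `|s *: u + of_real t *: (s *: v)| <= `|s| * (`|u| + `|v|) /\
    `|of_real t *: (s *: v)| <= `|s| * (`|u| + `|v|).
  rewrite in_itv/= => /andP[t0 t1].
  have H : `|of_real t *: (s *: v)| <= `|s| * `|v|.
    rewrite !normrZ norm_of_real (ger0_norm t0) ler_piMl ?mulr_ge0//.
    by rewrite -[1]of_real1 of_real_le.
  split; last by rewrite mulrDr (le_trans H)// lerDr mulr_ge0.
  by rewrite mulrDr (le_trans (ler_normD _ _))// lerD// normrZ.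
pose G q := f (q + s *: u) - f q.
have -> : f (p + s *: u + s *: v) - f (p + s *: u) - (f (p + s *: v) - f p) =
  G (p + s *: v) - G p.
  by rewrite /G (addrAC p); ring.
(* Outer 2: the mean value inequality. Factor |s|: the derivative of [G] is taken along s v. Inner
   2: two first-order expansions of [h], one at each end of the shift by s u. *)
have -> : 4 * e * (`|u| + `|v|) * `|s| ^+ 2 =
  2 * (`|s| * (2 * e * (`|s| * (`|u| + `|v|)))) by ring.
have dG (t : R) : t \in `[0, 1] -> is_derive (p + of_real t *: (s *: v)) (s *: v) G
   (s * (h (s *: u + of_real t *: (s *: v) + p) - h (of_real t *: (s *: v) + p))).
  move=> t01; have [H1 H2] := E1 t t01.
  have [[D1 _] [D2 _]] := (dP _ (le_lt_trans H1 sd), dP _ (le_lt_trans H2 sd)).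
  have E x : p + of_real t *: (s *: v) + x = x + of_real t *: (s *: v) + p.
    by rewrite addrC (addrC p) addrA.
  have D1' := D1; rewrite -E in D1'.
  have D2' := D2; rewrite addrC in D2'.
  have dG := is_deriveB (is_derive_shiftr (s *: v) D1')
    (derivableP (@diff_derivable _ _ _ _ _ (s *: v) D2')).
  apply: (is_derive_eq dG).
  rewrite (derive_dirZ s v D1') (derive_dirZ s v D2') -(scalerBr s) E.
  by rewrite -(addrC p (of_real t *: (s *: v))).
apply: mean_value_inequalityC => t t01; have H := dG t t01.
  by have [] := H.
rewrite derive_val expr2 -mulrA -mulrBr normrM ler_wpM2l//.
have [H1 H2] := E1 t t01.
have [_ D1] := dP _ (le_lt_trans H1 sd).
have [_ D2] := dP _ (le_lt_trans H2 sd).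
move: D1 D2; rewrite derive_dirD// => D1 D2.
rewrite -[s * 'D_u h p](derive_dirZ s u dh).
set x1 := h (_ + _ + p) in D1 *; set x2 := h (_ + p) in D2 *.
set l1 := 'D_(s *: u) h p in D1 *; set l2 := 'D__ h p in D1 D2.
have -> : x1 - x2 - l1 = (x1 - h p - (l1 + l2)) - (x2 - h p - l2) by ring.
apply: le_trans (ler_normB _ _) _; rewrite (mulr2n 1) mulrDl mul1r mulrDl.
apply: (@lerD C).
  exact: (le_trans D1 (ler_wpM2l (ltW e0) H1)).
exact: (le_trans D2 (ler_wpM2l (ltW e0) H2)).
Unshelve. all: by end_near. Qed.

(** Up to o(s^2), both sides times s^2 approximate the same second difference; one small nonzero s
    then refutes a positive [|a - b|]. *)
Lemma derive_sym (f : V -> C) (p u v : V) :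
  (\forall x \near p, differentiable f x) ->
  differentiable (fun x => 'D_u f x) p ->
  differentiable (fun x => 'D_v f x) p ->
  'D_u (fun x => 'D_v f x) p = 'D_v (fun x => 'D_u f x) p.
Proof.
move=> nf du dv; set a := LHS; set b := RHS.
apply/eqP; rewrite -subr_eq0 -normr_le0; apply/negPn/negP => abN.
have ab0 : 0 < `|a - b|.
  by rewrite lt0r normr_ge0 andbT; apply: contra abN => /eqP ->.
have K0 : 0 <= `|u| + `|v| by rewrite addr_ge0.
have K1 : 0 < 8 * (`|u| + `|v|) + 1 by rewrite ltr_wpDl// mulr_ge0.
(* Each second difference errs by at most 4 e (|u| + |v|) |s|^2, hence the 8 for both; the + 1 keeps
   the denominator positive when u and v vanish and makes the final inequality strict. *)
pose e := `|a - b| / (8 * (`|u| + `|v|) + 1).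
have e0 : 0 < e by rewrite divr_gt0.
have [s [s0 [H1 H2]]] : exists s : C, s != 0 /\
   (`|f (p + s *: u + s *: v) - f (p + s *: u) - (f (p + s *: v) - f p) - s ^+ 2 * a|
    <= 4 * e * (`|u| + `|v|) * `|s| ^+ 2 /\
   `|f (p + s *: v + s *: u) - f (p + s *: v) - (f (p + s *: u) - f p) - s ^+ 2 * b|
    <= 4 * e * (`|v| + `|u|) * `|s| ^+ 2).
  have H := @filterI _ _ (nbhs_filter (0 : C)) _ _
    (second_difference u e0 nf dv) (second_difference v e0 nf du).
  have [s s0 [Ha Hb]] := near0_ex H; exists s.
  by split=> [//|]; split; [exact: Ha|exact: Hb].
set D1 := (X in `|X - s ^+ 2 * a|) in H1.
rewrite [X in `|X - s ^+ 2 * b|](_ : _ = D1) in H2; last first.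
  by rewrite /D1 (addrAC p); ring.
have H3 : `|a - b| * `|s| ^+ 2 <= 8 * e * (`|u| + `|v|) * `|s| ^+ 2.
  rewrite -normrX -normrM.
  have -> : (a - b) * s ^+ 2 = (D1 - s ^+ 2 * b) - (D1 - s ^+ 2 * a) by ring.
  apply: (le_trans (ler_normB _ _)).
  apply: (le_trans (lerD H2 H1)).
  by rewrite le_eqVlt; apply/orP; left; apply/eqP; rewrite normrX; ring.
have {}H3 : `|a - b| <= 8 * e * (`|u| + `|v|).
  by move: H3; rewrite ler_pM2r// exprn_gt0// normr_gt0.
have lt : 8 * e * (`|u| + `|v|) < `|a - b|.
  have -> : `|a - b| = e * (8 * (`|u| + `|v|) + 1) by rewrite /e divfK// gt_eqF.
  have -> : 8 * e * (`|u| + `|v|) = e * (8 * (`|u| + `|v|)) by ring.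
  by rewrite (mulrDr e _ 1) mulr1 ltrDl.
by have := le_lt_trans H3 lt; rewrite ltxx.
Qed.

End SymmetricSecondDerivative.

(** * Holomorphic maps *)

Section DifferentialRules.
Context {K : numFieldType} {U V W : normedModType K}.

Lemma scaler_is_bilinear : bilinear_for
  (GRing.Scale.Law.clone _ _ *:%R _) (GRing.Scale.Law.clone _ _ *:%R _)
  (@GRing.scale K W : K -> W -> W).
Proof.
split=> [u'|u] a x y /=; first by rewrite scalerDl scalerA.
by rewrite scalerDr !scalerA mulrC.
Qed.

Let scale_bilin_mixin := bilinear_isBilinear.Build K K W W _ _
  (@GRing.scale K W : K -> W -> W) scaler_is_bilinear.
Let scale_bilin : {bilinear K -> W -> W} := HB.pack
  (@GRing.scale K W : K -> W -> W) scale_bilin_mixin.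

Lemma is_diff_scaler_pair (p : K * W) : differentiable (fun q : K * W => q.1 *: q.2) p /\
  ('d (fun q : K * W => q.1 *: q.2) p = (fun q => p.1 *: q.2 + q.1 *: p.2) :> (K * W -> W)).
Proof.
have sc : continuous (fun q : K * W => scale_bilin q.1 q.2).
  exact: scale_continuous.
split; first exact: (differentiable_bilin (f := scale_bilin)).
exact: (diff_bilin (f := scale_bilin)).
Qed.

Lemma is_diff_scaleF (f : V -> K) (g : V -> W) (p : V) :
  differentiable f p -> differentiable g p ->
  differentiable (fun x => f x *: g x) p /\
  forall v, 'D_v (fun x => f x *: g x) p = f p *: 'D_v g p + 'D_v f p *: g p.
Proof.
move=> df dg; have dfg := differentiable_pair df dg.
have [ds sE] := is_diff_scaler_pair (f p, g p).
have E : (fun x => f x *: g x) =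
    (fun q : K * W => q.1 *: q.2) \o (fun x => (f x, g x)) by [].
split; first by rewrite E; exact: differentiable_comp.
move=> v; rewrite E deriveE; last exact: differentiable_comp.
by rewrite diff_comp//= sE/= diff_pair//= !deriveE.
Qed.

Lemma derive_linear (L : {linear V -> W}) (p v : V) : continuous L ->
  'D_v L p = L v.
Proof. by move=> Lc; rewrite deriveE ?diff_lin//; exact: linear_differentiable. Qed.

Lemma derive_linear_comp (L : {linear V -> W}) (f : U -> V) (p v : U) :
  continuous L -> differentiable f p -> 'D_v (L \o f) p = L ('D_v f p).
Proof.
move=> Lc df; rewrite derive_comp//; last exact: linear_differentiable.
exact: derive_linear.
Qed.

Lemma derive_bigsum (I : Type) (r : seq I) (F : I -> V -> W) (p : V) :
  (forall i, differentiable (F i) p) ->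
  differentiable (fun q => \sum_(i <- r) F i q) p /\
  forall v, 'D_v (fun q => \sum_(i <- r) F i q) p = \sum_(i <- r) 'D_v (F i) p.
Proof.
move=> dF; elim: r => [|i r [dr Dr]].
  have -> : (fun q => \sum_(i <- [::]) F i q) = cst 0.
    by apply/funext => q; rewrite big_nil.
  by split=> [|v]; [exact: differentiable_cst|rewrite derive_cst big_nil].
have -> : (fun q => \sum_(j <- i :: r) F j q) = F i + (fun q => \sum_(j <- r) F j q).
  by apply/funext => q; rewrite big_cons.
split=> [|v]; first exact: differentiableD.
by rewrite deriveD ?Dr ?big_cons//; exact: diff_derivable.
Qed.

End DifferentialRules.

Section Holomorphic.
Context {R : realType}.
Local Notation C := (Cplx R).

Section Basic.
Context {V W : normedModType C}.
Implicit Types (U : set V) (f g : V -> W) (k : nat).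

Lemma holomorphic_differentiable U f x :
  holomorphic U f -> U x -> differentiable f x.
Proof. by move=> /(_ 1)[+ _]; apply. Qed.

Lemma holomorphic_derive U f v :
  holomorphic U f -> holomorphic U (fun x => 'D_v f x).
Proof. by move=> Hf k; have [_] := Hf k.+1; apply. Qed.

Lemma holomorphic_orderS k U f :
  holomorphic_order k.+1 U f -> holomorphic_order k U f.
Proof.
elim: k f => [//|k IH] f [df Df]; split=> // v.
by apply: IH; exact: Df.
Qed.

Lemma holomorphic_order_sub k U U' f : U' `<=` U ->
  holomorphic_order k U f -> holomorphic_order k U' f.
Proof.
move=> UU'; elim: k f => [//|k IH] f [df Df]; split=> [x /UU'|v].
  exact: df.
exact: IH (Df v).
Qed.

Lemma holomorphic_sub U U' f : U' `<=` U -> holomorphic U f -> holomorphic U' f.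
Proof. by move=> UU' Hf k; apply: holomorphic_order_sub UU' (Hf k). Qed.

Lemma eq_near U f g x : open U -> (forall x, U x -> f x = g x) -> U x ->
  \forall y \near x, f y = g y.
Proof.
by move=> Uo fg Ux; have := open_nbhs_nbhs (conj Uo Ux); apply: filterS.
Qed.

Lemma eq_open_derive U f g x v : open U -> (forall x, U x -> f x = g x) ->
  U x -> 'D_v f x = 'D_v g x.
Proof. by move=> Uo fg Ux; apply: near_eq_derive; exact: eq_near Ux. Qed.

Lemma near_eq_differentiable f g x : (\forall y \near x, f y = g y) ->
  differentiable f x -> differentiable g x.
Proof.
move=> fg df; have fgx : f x = g x := nbhs_singleton fg.
refine (proj1 (@eps_diff _ _ _ g ('d f x) x _ _)); first exact: diff_continuous.
move=> e e0; have := differentiable_eps df e0.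
have fg' : \forall y \near (0 : V), f (y + x) = g (y + x).
  by move: fg; rewrite (near_shift 0)/=; apply: filterS => y; rewrite /= subr0.
apply: filterS2 fg' => y fgy; rewrite fgx fgy deriveE//.
Qed.

Lemma eq_holomorphic_order k U f g : open U -> (forall x, U x -> f x = g x) ->
  holomorphic_order k U f -> holomorphic_order k U g.
Proof.
move=> Uo; elim: k f g => [//|k IH] f g fg [df Df]; split=> [x Ux|v].
  by apply: near_eq_differentiable (df x Ux); exact: eq_near Ux.
by apply: IH (Df v) => x Ux; exact: eq_open_derive Ux.
Qed.

Lemma eq_holomorphic U f g : open U -> (forall x, U x -> f x = g x) ->
  holomorphic U f -> holomorphic U g.
Proof. by move=> Uo fg Hf k; apply: eq_holomorphic_order Uo fg (Hf k). Qed.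

Lemma holomorphic_cst U (w : W) : holomorphic U (cst w).
Proof.
suff H k : forall w : W, holomorphic_order k U (cst w) by move=> k; exact: H.
elim: k => [//|k IH] {}w; split=> [x _|v]; first exact: differentiable_cst.
rewrite (_ : (fun _ => _) = cst 0) ?funeqE => [|x]; first exact: IH.
by rewrite derive_cst.
Qed.

Lemma holomorphic_orderD k U f g : open U -> holomorphic_order k U f ->
  holomorphic_order k U g -> holomorphic_order k U (fun x => f x + g x).
Proof.
move=> Uo; elim: k f g => [//|k IH] f g [df Df] [dg Dg].
split=> [x Ux|v]; first by apply: differentiableD; [exact: df|exact: dg].
apply: eq_holomorphic_order Uo _ (IH _ _ (Df v) (Dg v)) => x Ux.
by rewrite deriveD//; apply: diff_derivable; [exact: df|exact: dg].
Qed.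

Lemma holomorphicD U f g : open U -> holomorphic U f -> holomorphic U g ->
  holomorphic U (fun x => f x + g x).
Proof. by move=> Uo Hf Hg k; exact: holomorphic_orderD. Qed.

Lemma holomorphic_orderZ k U (c : C) f : open U -> holomorphic_order k U f ->
  holomorphic_order k U (fun x => c *: f x).
Proof.
move=> Uo; elim: k f => [//|k IH] f [df Df].
split=> [x Ux|v]; first by apply: differentiableZ; exact: df.
apply: eq_holomorphic_order Uo _ (IH _ (Df v)) => x Ux.
by rewrite deriveZ//; apply: diff_derivable; exact: df.
Qed.

Lemma holomorphicZ U (c : C) f : open U -> holomorphic U f ->
  holomorphic U (fun x => c *: f x).
Proof. by move=> Uo Hf k; exact: holomorphic_orderZ. Qed.

Lemma holomorphicB U f g : open U -> holomorphic U f -> holomorphic U g ->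
  holomorphic U (fun x => f x - g x).
Proof.
move=> Uo Hf Hg; apply: (eq_holomorphic Uo _ (holomorphicD Uo Hf (holomorphicZ (-1) Uo Hg))).
by move=> x _; rewrite scaleN1r.
Qed.

Lemma holomorphic_sum (I : Type) (r : seq I) (P : pred I) U (F : I -> V -> W) :
  open U -> (forall i, P i -> holomorphic U (F i)) ->
  holomorphic U (fun x => \sum_(i <- r | P i) F i x).
Proof.
move=> Uo HF; elim: r => [|i r IH].
  by apply: (eq_holomorphic Uo _ (holomorphic_cst U 0)) => x _; rewrite big_nil.
case Pi : (P i); last first.
  by apply: (eq_holomorphic Uo _ IH) => x _; rewrite big_cons Pi.
apply: (eq_holomorphic Uo _ (holomorphicD Uo (HF _ Pi) IH)) => x _.
by rewrite big_cons Pi.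
Qed.

End Basic.

Lemma holomorphic_id {V : normedModType C} (U : set V) : open U -> holomorphic U id.
Proof.
move=> Uo [//|k]; split=> [x _|v]; first exact: ex_diff.
apply: (eq_holomorphic_order Uo _ (holomorphic_cst U v k)) => x _.
by rewrite derive_id.
Qed.

Section Composition.
Context {V W W' : normedModType C}.

Lemma holomorphic_linear_comp (U : set V) (f : V -> W) (L : {linear W -> W'}) :
  open U -> continuous L -> holomorphic U f -> holomorphic U (L \o f).
Proof.
move=> Uo Lc Hf k; elim: k f {Hf}(Hf k) => [//|k IH] f [df Df].
split=> [x Ux|v].
  by apply: differentiable_comp; [exact: df|exact: linear_differentiable].
apply: eq_holomorphic_order Uo _ (IH _ (Df v)) => x Ux /=.
by rewrite derive_linear_comp//; exact: df.
Qed.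

Lemma holomorphic_comp_linear (U : set W) (f : W -> W') (L : {linear V -> W}) :
  open U -> continuous L -> holomorphic U f -> holomorphic (L @^-1` U) (f \o L).
Proof.
move=> Uo Lc Hf k; elim: k f {Hf}(Hf k) => [//|k IH] f [df Df].
have Uo' : open (L @^-1` U) by apply: open_comp => // x _; exact: Lc.
split=> [x Ux|v].
  by apply: differentiable_comp; [exact: linear_differentiable|exact: df].
apply: eq_holomorphic_order Uo' _ (IH _ (Df (L v))) => x Ux /=.
have -> : 'D_v (f \o L) x = 'D_('D_v L x) f (L x).
  by apply: derive_comp; [exact: linear_differentiable|exact: df].
by rewrite (derive_linear _ _ Lc).
Qed.

Lemma holomorphic_scaleF (U : set V) (f : V -> C) (g : V -> W) :
  open U -> holomorphic U f -> holomorphic U g ->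
  holomorphic U (fun x => f x *: g x).
Proof.
move=> Uo Hf Hg k; elim: k f g {Hf Hg}(Hf k) (Hg k) => [//|k IH] f g Hf Hg.
have [[df Df] [dg Dg]] := (Hf, Hg).
split=> [x Ux|v]; first by have [] := is_diff_scaleF (df x Ux) (dg x Ux).
have H1 := IH _ _ (holomorphic_orderS Hf) (Dg v).
have H2 := IH _ _ (Df v) (holomorphic_orderS Hg).
apply: eq_holomorphic_order Uo _ (holomorphic_orderD Uo H1 H2) => x Ux.
by have [_ ->] := is_diff_scaleF (df x Ux) (dg x Ux).
Qed.

End Composition.

(** [holomorphic] speaks of derivatives in fixed directions only. Finitely many continuous
    coordinates allow a varying direction [X p] to be expanded over fixed ones, and vector
    identities to be tested on scalar components. *)
Record coordinates (V : normedModType C) := Coordinates {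
  cidx : finType;
  cbase : cidx -> V;
  ccoord : cidx -> {linear V -> C};
  continuous_ccoord : forall i, continuous (ccoord i);
  ccoord_sum : forall v, v = \sum_i ccoord i v *: cbase i
}.

Section Coordinates.
Context {V : normedModType C} (B : coordinates V).

Lemma ccoord_inj (u v : V) : (forall i, ccoord (c := B) i u = ccoord i v) -> u = v.
Proof.
move=> uv; rewrite (ccoord_sum B u) (ccoord_sum B v).
by apply: eq_bigr => i _; rewrite uv.
Qed.

Lemma derive_cbase {W : normedModType C} (f : V -> W) (p v : V) :
  differentiable f p ->
  'D_v f p = \sum_i ccoord i v *: 'D_(cbase (c := B) i) f p.
Proof.
move=> df; rewrite deriveE// {1}(ccoord_sum B v) linear_sum.
by apply: eq_bigr => i _; rewrite linearZ deriveE.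
Qed.

Lemma holomorphic_ccoord {V' : normedModType C} (U : set V') (X : V' -> V) i :
  open U -> holomorphic U X -> holomorphic U (fun p => ccoord (c := B) i (X p)).
Proof.
move=> Uo HX.
exact: (holomorphic_linear_comp Uo (continuous_ccoord (c := B) (i := i)) HX).
Qed.

Lemma derive_ccoord i (p v : V) :
  'D_v (ccoord (c := B) i) p = ccoord i v.
Proof. exact: (derive_linear p v (continuous_ccoord (c := B) (i := i))). Qed.

Lemma holomorphic_derive_dir {W : normedModType C} (U : set V) (f : V -> W)
    (X : V -> V) : open U -> holomorphic U f -> holomorphic U X ->
  holomorphic U (fun p => 'D_(X p) f p).
Proof.
move=> Uo Hf HX.
apply: (@eq_holomorphic _ _ _
  (fun p => \sum_i ccoord (c := B) i (X p) *: 'D_(cbase i) f p) _ Uo).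
  move=> p Up; rewrite -derive_cbase//; exact: holomorphic_differentiable Up.
apply: holomorphic_sum => // i _; apply: holomorphic_scaleF => //.
  exact: holomorphic_ccoord.
exact: holomorphic_derive.
Qed.

Lemma holomorphic_coordinates {V' : normedModType C} (U : set V') (f : V' -> V) :
  open U -> (forall i, holomorphic U (fun p => ccoord (c := B) i (f p))) ->
  holomorphic U f.
Proof.
move=> Uo Hf.
apply: (eq_holomorphic (f := fun p => \sum_i ccoord i (f p) *: cbase (c := B) i) Uo).
  by move=> p _; rewrite -ccoord_sum.
apply: holomorphic_sum => // i _; apply: holomorphic_scaleF => //.
exact: holomorphic_cst.
Qed.

End Coordinates.

End Holomorphic.

(** * Integration along the fibres *)

Lemma continuous_sum (K : numFieldType) (V : normedModType K) (T : topologicalType)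
  (J : Type) (r : seq J) (F : J -> T -> V) : (forall j, continuous (F j)) ->
  continuous (fun x => \sum_(j <- r) F j x).
Proof.
move=> Fc; elim: r => [|j r IHr].
  have -> : (fun x => \sum_(j <- [::]) F j x) = cst 0.
    by apply/funext => x; rewrite big_nil.
  by move=> x; exact: cvg_cst.
have -> : (fun x => \sum_(j <- j :: r) F j x) = (fun x => F j x + \sum_(j <- r) F j x).
  by apply/funext => x; rewrite big_cons.
by move=> x; apply: cvgD; [exact: Fc|exact: IHr].
Qed.

Section ComplexIntegral.
Context {R : realType}.
Local Notation C := (Cplx R).
Local Notation mu := (@lebesgue_measure R).

Definition im (z : C) : R := @complex.Im R z.

Lemma im_re (z : C) : im z = re (- 'i * z).
Proof. by rewrite -complexiE; case: z => a b; rewrite /im /re /=; simpc. Qed.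

Lemma continuous_im : continuous im.
Proof.
have -> : im = re \o (fun z => - 'i * z) by apply/funext => z; exact: im_re.
move=> z; apply: continuous_comp; last exact: continuous_re.
exact: mulrl_continuous.
Qed.

Definition rint (f : R -> R) : R := \int[mu]_(t in `[0, 1]) f t.

Definition cint (f : R -> C) : C := Complex (rint (re \o f)) (rint (im \o f)).

Lemma integrable01 (f : R -> R) : continuous f ->
  mu.-integrable `[0, 1] (EFin \o f).
Proof.
move=> fc; apply: continuous_compact_integrable; first exact: segment_compact.
exact: continuous_subspaceT.
Qed.

Lemma continuous_re_comp (f : R -> C) : continuous f -> continuous (re \o f).
Proof.
by move=> fc x; apply: continuous_comp; [exact: fc|exact: continuous_re].
Qed.

Lemma continuous_im_comp (f : R -> C) : continuous f -> continuous (im \o f).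
Proof.
by move=> fc x; apply: continuous_comp; [exact: fc|exact: continuous_im].
Qed.

Lemma cintD (f g : R -> C) : continuous f -> continuous g ->
  cint (fun t => f t + g t) = cint f + cint g.
Proof.
move=> fc gc; rewrite /cint [RHS]/GRing.add/=; congr Complex.
  rewrite /rint -RintegralD//; last 2 first.
  - exact/integrable01/continuous_re_comp.
  - exact/integrable01/continuous_re_comp.
  by apply: eq_Rintegral => t _; rewrite /= reD.
rewrite /rint -RintegralD//; last 2 first.
- exact/integrable01/continuous_im_comp.
- exact/integrable01/continuous_im_comp.
by apply: eq_Rintegral => t _ /=; case: (f t) (g t) => ? ? [? ?].
Qed.

Lemma cintZ (c : C) (f : R -> C) : continuous f ->
  cint (fun t => c * f t) = c * cint f.
Proof.
move=> fc; rewrite /cint; case: c => a b; rewrite [RHS]/GRing.mul/=.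
have ire := integrable01 (continuous_re_comp fc).
have iim := integrable01 (continuous_im_comp fc).
have Zc (g : R -> R) (r : R) : continuous g -> continuous (fun t => r * g t).
  by move=> gc t; apply: cvgM; [exact: cvg_cst|exact: gc].
have rec := continuous_re_comp fc; have imc := continuous_im_comp fc.
congr Complex; rewrite /rint -!RintegralZl//.
- rewrite -RintegralB//; last 2 first.
  + exact/integrable01/Zc.
  + exact/integrable01/Zc.
  by apply: eq_Rintegral => t _ /=; case: (f t).
- rewrite -RintegralD//; last 2 first.
  + exact/integrable01/Zc.
  + exact/integrable01/Zc.
  by apply: eq_Rintegral => t _ /=; case: (f t).
Qed.

Lemma cintB (f g : R -> C) : continuous f -> continuous g ->
  cint (fun t => f t - g t) = cint f - cint g.
Proof.
move=> fc gc; have gc' : continuous (fun t => -1 * g t).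
  by move=> t; apply: cvgM; [exact: cvg_cst|exact: gc].
rewrite -mulN1r -cintZ// -cintD//; congr cint.
by apply/funext => t; rewrite mulN1r.
Qed.

Lemma cint_sum (J : finType) (F : J -> R -> C) : (forall j, continuous (F j)) ->
  cint (fun t => \sum_j F j t) = \sum_j cint (F j).
Proof.
move=> Fc.
have sumc (r : seq J) : continuous (fun t => \sum_(j <- r) F j t).
  exact: continuous_sum.
elim: (index_enum _) => [|j r IHr].
  rewrite big_nil -[RHS](mul0r (cint (cst 0))) -cintZ; last by move=> t; exact: cvg_cst.
  by congr cint; apply/funext => t; rewrite big_nil mul0r.
rewrite big_cons -IHr -cintD//.
by congr cint; apply/funext => t; rewrite big_cons.
Qed.

Lemma rint_le (f : R -> R) (e : R) : continuous f ->
  (forall t, t \in `[0, 1] -> `|f t| <= e) -> `|rint f| <= e.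
Proof.
move=> fc fe; apply: le_trans (le_normr_Rintegral _ (integrable01 fc)) _ => //.
have fnc : continuous (fun t => `|f t|).
  by move=> t; apply: continuous_comp; [exact: fc|exact: norm_continuous].
have -> : e = \int[mu]_(t in `[0, 1]) e.
  have mu01 : mu [set` `[0 : R, 1 : R]] = 1%E.
    by rewrite lebesgue_measure_itv/= lte01 oppr0 adde0.
  rewrite Rintegral_cst//; transitivity (e * fine (1%E : \bar R)).
    by rewrite mulr1.
  by congr (e * fine _); rewrite -mu01.
apply: le_Rintegral => //; first exact: integrable01.
by apply: (@integrable01 (cst e)) => t; exact: cvg_cst.
Qed.

(** Real and imaginary parts are bounded separately, which costs the factor 2; it is harmless where
    the bound can be made arbitrarily small. *)
Lemma cint_le (f : R -> C) (e : C) : continuous f ->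
  (forall t : R, t \in `[0, 1] -> `|f t| <= e) -> `|cint f| <= 2 * e.
Proof.
move=> fc fe.
have e0 : 0 <= e.
  by apply: le_trans (fe 0 _); rewrite ?normr_ge0// in_itv/= lexx ler01.
apply: le_trans (norm_le_re _) _; rewrite -im_re.
rewrite mulr2n mulrDl mul1r {1 2}(ge0_of_real e0) lerD// of_real_le.
- rewrite rint_le//; first exact: continuous_re_comp.
  by move=> t t01; apply: re_le; rewrite -ge0_of_real//; exact: fe.
- rewrite rint_le//; first exact: continuous_im_comp.
  move=> t t01; rewrite /= im_re; apply: re_le; rewrite -ge0_of_real//.
  by rewrite normrM normrN normCi mul1r; exact: fe.
Qed.

Lemma rint_FTC (F f : R -> R) : continuous f ->
  (forall t : R, is_derive t 1 F (f t)) -> rint f = F 1 - F 0.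
Proof.
move=> fc dF.
have Fc : continuous F.
  by move=> t; apply: differentiable_continuous; apply/derivable1_diffP; have [] := dF t.
rewrite /rint /Rintegral (@continuous_FTC2 _ f F)//.
- exact: continuous_subspaceT.
- split; first by move=> t _; have [] := dF t.
  + by apply: cvg_at_right_filter; exact: Fc.
  + by apply: cvg_at_left_filter; exact: Fc.
- by move=> t _; rewrite derive1E; have [_ ->] := dF t.
Qed.

End ComplexIntegral.

Section TangentCoordinates.
Context {R : realType} {n : nat}.
Local Notation C := (Cplx R).
Local Notation E := ('rV[C]_n).
Local Notation TE := (E * E)%type.
Local Notation I := ('I_n + 'I_n)%type.

(** [inl] indexes the directions along M and [inr] those along the fibre: [tbase (inr l)] is the
    value of the constant field v on the l-th coordinate vector. *)
Definition tbase (i : I) : TE :=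
  match i with inl j => (delta_mx 0 j, 0) | inr j => (0, delta_mx 0 j) end.

Definition tcoord (i : I) (v : TE) : C :=
  match i with inl j => v.1 0 j | inr j => v.2 0 j end.

Lemma tcoord_linear i : linear (tcoord i : TE -> C).
Proof. by case: i => j a x y /=; rewrite !mxE. Qed.

HB.instance Definition _ i :=
  GRing.isLinear.Build C TE C *:%R (tcoord i) (tcoord_linear i).

Lemma continuous_tcoord i : continuous (tcoord i).
Proof.
case: i => j v.
  apply: (@continuous_comp _ _ _ fst (fun x : E => x 0 j)); first exact: cvg_fst.
  exact: coord_continuous.
apply: (@continuous_comp _ _ _ snd (fun x : E => x 0 j)); first exact: cvg_snd.
exact: coord_continuous.
Qed.

Lemma tbase_sum (v : TE) : v = \sum_i tcoord i v *: tbase i.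
Proof.
rewrite big_sumType/= [LHS]surjective_pairing.
transitivity ((v.1, 0) + (0, v.2) : TE).
  by congr pair => /=; rewrite ?addr0 ?add0r.
rewrite {1}[v.1]row_sum_delta {1}[v.2]row_sum_delta; congr (_ + _).
  elim/big_rec2: _ => [//|j x y _ <-]; congr pair.
  by rewrite /= scaler0 addr0.
elim/big_rec2: _ => [//|j x y _ <-]; congr pair.
by rewrite /= scaler0 addr0.
Qed.

Lemma tcoord_bounded :
  exists2 K : C, 0 < K & forall v : TE, \sum_i `|tcoord i v| <= K * `|v|.
Proof.
have /choice[K HK] i : exists k : C, 0 < k /\ forall v : TE, `|tcoord i v| <= k * `|v|.
  by have [k k0 kP] := linear_lipschitz (f := tcoord i) (@continuous_tcoord i); exists k.
exists (\sum_i K i + 1).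
  by rewrite ltr_wpDl// sumr_ge0// => i _; apply: ltW; exact: (HK i).1.
move=> v; rewrite mulrDl mulr_suml.
apply: ler_wpDr; first by rewrite mul1r.
by apply: ler_sum => i _; exact: (HK i).2.
Qed.

Definition tcoordinates : coordinates TE :=
  Coordinates (ccoord := fun i => tcoord i : {linear TE -> C})
    continuous_tcoord tbase_sum.

Lemma derive_tbase {W : normedModType C} (f : TE -> W) (p v : TE) :
  differentiable f p ->
  'D_v f p = \sum_i tcoord i v *: 'D_(tbase i) f p.
Proof. exact: (derive_cbase tcoordinates). Qed.

Definition fscale (t : R) (p : TE) : TE := (p.1, of_real t *: p.2).

Lemma fscaleD t p q : fscale t (p + q) = fscale t p + fscale t q.
Proof. by rewrite /fscale/= scalerDr. Qed.

Lemma norm_fscale t p : t \in `[0, 1] -> `|fscale t p| <= `|p|.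
Proof.
rewrite in_itv/= => /andP[t0 t1].
rewrite !prod_normE num_ge_max/= num_le_max lexx/= num_le_max; apply/orP; right.
rewrite normrZ norm_of_real (ger0_norm t0) ler_piMl//.
by rewrite -[1]of_real1 of_real_le.
Qed.

Lemma continuous_fscale p : continuous (fscale ^~ p).
Proof.
have -> : fscale ^~ p = fun t => (p.1, 0) + of_real t *: ((0, p.2) : TE).
  apply/funext => t; congr pair => /=; first by rewrite scaler0 addr0.
  by rewrite add0r.
move=> t; apply: cvgD; first exact: cvg_cst.
apply: cvgZ; [exact: continuous_of_real|exact: cvg_cst].
Qed.

Section FibreIntegral.
Variables (W : set E) (Wo : open W).
Let U : set TE := [set p | W p.1].

Lemma open_fibres : open U.
Proof. by apply: open_comp => // p _; exact: cvg_fst. Qed.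

(** Strict differentiability: one radius serves every base point [q] near [q0]. It follows from
    continuity of the finitely many partial derivatives at [q0] and the mean value inequality on the
    segment from [q] to [q + w]. *)
Lemma uniform_differentiable_at (f : TE -> C) (q0 : TE) (e : C) :
  holomorphic U f -> U q0 -> 0 < e ->
  exists2 r : C, 0 < r & forall q w : TE,
    (forall s : R, s \in `[0, 1] -> `|q0 - (q + of_real s *: w)| < r) ->
    `|f (q + w) - f q - 'D_w f q| <= e * `|w|.
Proof.
move=> Hf Uq0 e0; have [K K0 HK] := tcoord_bounded.
(* The 4 is the 2 of the mean value inequality times the 2 from comparing two points with [q0]; [K]
   bounds the sum of the coordinates by the norm. *)
pose e1 := e / (4 * K).
have e10 : 0 < e1 by rewrite divr_gt0// mulr_gt0.
have nU : \forall y \near q0, U y.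
  exact: open_nbhs_nbhs (conj open_fibres Uq0).
have nD : \forall y \near q0, forall i,
    `|'D_(tbase i) f q0 - 'D_(tbase i) f y| <= e1.
  apply: (@filter_forall _ _ (fun i y =>
    `|'D_(tbase i) f q0 - 'D_(tbase i) f y| <= e1) (nbhs q0) _) => i.
  have Dc : {for q0, continuous (fun y => 'D_(tbase i) f y)}.
    apply: differentiable_continuous.
    by apply: (holomorphic_differentiable _ Uq0); exact: holomorphic_derive.
  by move/cvgrPdist_le : Dc; apply.
have /nbhs_ballP[r /= r0 rP] : \forall y \near q0, U y /\
    forall i, `|'D_(tbase i) f q0 - 'D_(tbase i) f y| <= e1.
  by near=> y; split; near: y.
exists r => // q w H.
have HP (s : R) : s \in `[0, 1] -> U (q + of_real s *: w) /\
    forall i, `|'D_(tbase i) f q0 - 'D_(tbase i) f (q + of_real s *: w)| <= e1.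
  by move=> s01; apply: rP; rewrite -ball_normE; exact: H.
have q01 : 0 \in `[0 : R, 1] by rewrite in_itv/= lexx ler01.
have df (s : R) : s \in `[0, 1] -> differentiable f (q + of_real s *: w : TE).
  by move=> /HP[+ _]; exact: holomorphic_differentiable.
have -> : e * `|w| = 2 * (2 * e1 * (K * `|w|)).
  by rewrite /e1; field; rewrite gt_eqF.
apply: mean_value_inequalityC => s s01.
  exact/diff_derivable/df.
have [_ H1] := HP _ s01; have [_ H0] := HP _ q01.
have dq := df _ q01; rewrite of_real0 scale0r addr0 in H0 dq.
rewrite (derive_tbase _ (df _ s01)) (derive_tbase _ dq) -sumrB.
apply: (le_trans (ler_norm_sum _ _ _)).
apply: (@le_trans _ _ (\sum_i `|tcoord i w| * (2 * e1))); last first.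
  by rewrite -mulr_suml mulrC ler_wpM2l// mulr_ge0// ltW.
apply: ler_sum => i _; rewrite -scalerBr normrZ ler_wpM2l//.
rewrite -[X in `|X|](subrKA ('D_(tbase i) f q0)) mulr2n mulrDl mul1r.
apply: (le_trans (ler_normD _ _)); apply: (@lerD C); last exact: H0.
by rewrite distrC; exact: H1.
Unshelve. all: by end_near. Qed.

(** Differentiating under the integral requires a neighbourhood of 0 independent of t. Compactness
    of [0, 1], in its near-covering form, extracts it from the local estimates. *)
Lemma uniform_differentiable (f : TE -> C) (p : TE) (e : C) :
  holomorphic U f -> U p -> 0 < e ->
  \forall x \near (0 : TE), forall t : R, t \in `[0, 1] ->
    `|f (fscale t (x + p)) - f (fscale t p) - 'D_(fscale t x) f (fscale t p)|
    <= e * `|x|.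
Proof.
move=> Hf Up e0.
have /compact_near_coveringP cpt := @segment_compact R 0 1.
pose P (x : TE) (t : R) := t \in `[0, 1] ->
    `|f (fscale t (x + p)) - f (fscale t p) - 'D_(fscale t x) f (fscale t p)|
    <= e * `|x|.
have : \forall x \near (0 : TE), [set` `[0 : R, 1]] `<=` P x.
  apply: (cpt TE (nbhs (0 : TE)) P _) => t0 t01.
  have [r r0 rP] := uniform_differentiable_at Hf (Up : U (fscale t0 p)) e0.
  (* Half of the radius is spent on moving t away from [t0], the other half on the displacement
     [x]. *)
  have r2 : 0 < r / 2 by rewrite divr_gt0.
  have nt : \forall t \near t0, `|fscale t0 p - fscale t p| < r / 2.
    have /cvgrPdist_lt := @continuous_fscale p t0; exact.
  have nx : \forall x \near (0 : TE), `|x| < r / 2 by exact: nbhs0_lt.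
  exists ([set t | `|fscale t0 p - fscale t p| < r / 2], [set x | `|x| < r / 2]) => //.
  move=> [t x] [/= Ht Hx] t01'.
  rewrite fscaleD [fscale t x + _]addrC.
  apply: (@le_trans _ _ (e * `|fscale t x|)); last first.
    by apply: ler_wpM2l; [exact: ltW|exact: norm_fscale].
  apply: rP => s; rewrite in_itv/= => /andP[s0 s1].
  rewrite opprD addrA [ltRHS](splitr r).
  apply: (le_lt_trans (ler_normB _ _)); apply: ltrD => //.
  rewrite normrZ norm_of_real (ger0_norm s0).
  apply: le_lt_trans Hx; apply: le_trans (norm_fscale x t01').
  by rewrite ler_piMl// -[1]of_real1 of_real_le.
by apply: filterS => x Hx t t01; apply: Hx.
Qed.

(* The weight t ^+ a makes this family of operators stable under
   differentiation: each derivative in a fibre direction raises a by one. *)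
Definition fint (a : nat) (f : TE -> C) (p : TE) : C :=
  cint (fun t => of_real t ^+ a * f (fscale t p)).

(** Holds for every real t, since [U] is a union of whole fibres and so contains the whole line
    through [p]. *)
Lemma continuous_fint a (f : TE -> C) (p : TE) : holomorphic U f -> U p ->
  continuous (fun t => of_real t ^+ a * f (fscale t p)).
Proof.
move=> Hf Up t; apply: cvgM.
  by rewrite -of_realX; under eq_fun do rewrite -of_realX;
    apply: (@continuous_comp _ _ _ (fun x : R => x ^+ a) (@of_real R));
    [exact: exprn_continuous|exact: continuous_of_real].
apply: (@continuous_comp _ _ _ (fscale ^~ p) f).
  exact: continuous_fscale.
apply: differentiable_continuous; exact: holomorphic_differentiable Hf _.
Qed.

Definition fdeg (i : I) : nat := if i is inr _ then 1 else 0.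

Lemma tcoord_fscale i t v : tcoord i (fscale t v) = of_real t ^+ fdeg i * tcoord i v.
Proof. by case: i => j /=; rewrite ?mxE ?mul1r. Qed.

Lemma derive_fscale (f : TE -> C) (p : TE) (t : R) v : holomorphic U f -> U p ->
  'D_(fscale t v) f (fscale t p) =
  \sum_i of_real t ^+ fdeg i * tcoord i v * 'D_(tbase i) f (fscale t p).
Proof.
move=> Hf Up; rewrite derive_tbase; last exact: holomorphic_differentiable Hf _.
by apply: eq_bigr => i _; rewrite tcoord_fscale.
Qed.

(** Differentiation under the integral sign. The first-order expansion is uniform in t, so it may be
    integrated against the weight, which is at most 1; the chain rule along [fscale t] adds [fdeg i]
    to the exponent of the weight. *)
Lemma is_diff_fint a (f : TE -> C) (p : TE) : holomorphic U f -> U p ->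
  differentiable (fint a f) p /\ forall v, 'D_v (fint a f) p =
    \sum_i tcoord i v * fint (a + fdeg i) (fun q => 'D_(tbase i) f q) p.
Proof.
move=> Hf Up.
pose L v := \sum_i tcoord i v * fint (a + fdeg i) (fun q => 'D_(tbase i) f q) p.
have L_linear : linear (L : TE -> C).
  move=> k x y; rewrite /L scaler_sumr -big_split/=; apply: eq_bigr => i _.
  rewrite linearP/= mulrDl; congr (_ + _).
  exact: (esym (mulrA k _ _)).
pose LM := GRing.isLinear.Build C TE C *:%R L L_linear.
pose LL : {linear TE -> C} := HB.pack L LM.
have Lc : continuous LL.
  apply: continuous_sum => i x.
  by apply: cvgM; [exact: continuous_tcoord|exact: cvg_cst].
have HD i : holomorphic U (fun q => 'D_(tbase i) f q) by exact: holomorphic_derive.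
have [|df dE] := @eps_diff _ _ _ (fint a f) LL p Lc; last first.
  by split=> // v; rewrite deriveE// dE.
(* The half compensates the factor 2 of [cint_le]. *)
move=> e e0; have e2 : 0 < e / 2 by rewrite divr_gt0.
have nU : \forall x \near (0 : TE), U (x + p).
  have := open_nbhs_nbhs (conj open_fibres Up).
  by rewrite -[nbhs p U]/(\forall x \near p, U x) (near_shift 0)/= => H;
    apply: filterS H => x; rewrite /= subr0.
near=> x.
have Uxp : U (x + p) by near: x.
have Hx : forall t : R, t \in `[0, 1] ->
    `|f (fscale t (x + p)) - f (fscale t p) - 'D_(fscale t x) f (fscale t p)|
    <= e / 2 * `|x|.
  by near: x; exact: uniform_differentiable.
have Dc i := continuous_fint (a := a + fdeg i) (HD i) Up.
pose G i t := tcoord i x * (of_real t ^+ (a + fdeg i) * 'D_(tbase i) f (fscale t p)).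
have Gc i : continuous (G i).
  by move=> t; apply: cvgM; [exact: cvg_cst|exact: Dc].
have GE : (fun t => of_real t ^+ a * 'D_(fscale t x) f (fscale t p)) =
    (fun t => \sum_i G i t).
  apply/funext => t; rewrite derive_fscale// mulr_sumr.
  apply: eq_bigr => i _; rewrite /G exprD.
  by rewrite !mulrA; congr (_ * _); rewrite mulrC mulrA.
have Dcc : continuous (fun t => of_real t ^+ a * 'D_(fscale t x) f (fscale t p)).
  by rewrite GE; exact: continuous_sum.
have -> : LL x = cint (fun t => of_real t ^+ a * 'D_(fscale t x) f (fscale t p)).
  rewrite GE (cint_sum Gc) [LHS]/= /L.
  by apply: eq_bigr => i _; rewrite (cintZ _ (Dc i)).
have c1 := continuous_fint (a := a) Hf Uxp; have c2 := continuous_fint (a := a) Hf Up.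
pose A t := of_real t ^+ a * f (fscale t (x + p)).
pose B t := of_real t ^+ a * f (fscale t p).
pose D t := of_real t ^+ a * 'D_(fscale t x) f (fscale t p).
have cAB : continuous (fun t => A t - B t).
  by move=> t; apply: cvgB; [exact: c1|exact: c2].
have cABD : continuous (fun t => A t - B t - D t).
  by move=> t; apply: cvgB; [exact: cAB|exact: Dcc].
have -> : fint a f (x + p) - fint a f p - cint D = cint (fun t => A t - B t - D t).
  by rewrite (cintB cAB Dcc) (cintB c1 c2).
have -> : e * `|x| = 2 * (e / 2 * `|x|) by field.
apply: cint_le => [//|t t01]; rewrite /A /B /D.
rewrite -!mulrBr normrM -[leRHS]mul1r; apply: ler_pM => //; last exact: Hx.
move: t01; rewrite in_itv/= => /andP[t0 t1].
rewrite normrX norm_of_real (ger0_norm t0) -of_realX -[1]of_real1 of_real_le.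
exact: exprn_ile1.
Unshelve. all: by end_near. Qed.

Lemma holomorphic_fint a (f : TE -> C) : holomorphic U f -> holomorphic U (fint a f).
Proof.
move=> + k; elim: k a f => [//|k IH] a f Hf; split=> [p Up|v].
  exact: (is_diff_fint a Hf Up).1.
apply: (@eq_holomorphic_order _ _ _ _ _
  (fun p => \sum_i tcoord i v * fint (a + fdeg i) (fun q => 'D_(tbase i) f q) p)).
- exact: open_fibres.
- by move=> p Up; rewrite (is_diff_fint a Hf Up).2.
have H i : holomorphic_order k U
    (fun p => tcoord i v * fint (a + fdeg i) (fun q => 'D_(tbase i) f q) p).
  apply: holomorphic_orderZ; first exact: open_fibres.
  by apply: IH; exact: holomorphic_derive.
elim: (index_enum _) => [|i r IHr].
  apply: (eq_holomorphic_order open_fibres _ (holomorphic_cst U (0 : C) k)) => p _.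
  by rewrite big_nil.
apply: (eq_holomorphic_order open_fibres _ (holomorphic_orderD open_fibres (H i) IHr)) => p _.
by rewrite big_cons.
Qed.

End FibreIntegral.

End TangentCoordinates.

(** * The Poincare lemma along the fibres *)

Section FibrePrimitive.
Context {R : realType} {n : nat}.
Local Notation C := (Cplx R).
Local Notation E := ('rV[C]_n).
Local Notation TE := (E * E)%type.

Lemma cint_FTC (G : C -> C) (g : R -> C) :
  (forall t : R, is_derive (of_real t : C) (1 : C) G (g t)) -> continuous g ->
  cint g = G 1 - G 0.
Proof.
move=> dG gc.
have dre (u : C) (t : R) : is_derive t (1 : R) (fun t => re (u * G (of_real t))) (re (u * g t)).
  have E s : 0 + of_real s *: (1 : C) = of_real s by rewrite add0r [_ *: _]mulr1.
  have [dGt <-] := dG t.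
  have := @is_derive_re R C G u 0 1 t.
  rewrite E => /(_ dGt).
  by under eq_fun do rewrite E.
have [E1 E2] : rint (re \o g) = re (G 1) - re (G 0) /\
               rint (im \o g) = im (G 1) - im (G 0).
  split.
    apply: (@rint_FTC _ (fun t => re (G (of_real t)))).
      exact: continuous_re_comp.
    by move=> t; have := dre 1 t; rewrite mul1r; under eq_fun do rewrite mul1r.
  rewrite !im_re.
  apply: (@rint_FTC _ (fun t => re (- 'i * G (of_real t)))).
    exact: continuous_im_comp.
  by move=> t; rewrite /= im_re; exact: dre.
rewrite /cint E1 E2; case: (G 1) (G 0) => ? ? [? ?].
by [].
Qed.

Variables (W : set E) (Wo : open W).
Let U : set TE := [set p | W p.1].

(* The left-hand side is the integral over [0, 1] of the derivative of
   t |-> t * f (z, t * theta). *)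
Lemma fint_euler (f : TE -> C) (p : TE) : holomorphic U f -> U p ->
  fint 0 f p + \sum_l p.2 0 l * fint 1 (fun q => 'D_(tbase (inr l)) f q) p = f p.
Proof.
move=> Hf Up.
pose g t := f (fscale t p) + of_real t * 'D_(0, p.2) f (fscale t p).
have dfa (s : C) : differentiable f ((p.1, s *: p.2) : TE).
  exact: holomorphic_differentiable Hf _.
have gE : g = fun t => of_real t ^+ 0 * f (fscale t p) +
   \sum_l p.2 0 l * (of_real t ^+ 1 * 'D_(tbase (inr l)) f (fscale t p)).
  apply/funext => t; rewrite /g expr0 mul1r expr1; congr (_ + _).
  rewrite derive_tbase; last exact: dfa.
  rewrite big_sumType/= [X in X + _]big1 ?add0r; last first.
    by move=> i _; rewrite mxE scale0r.
  by rewrite mulr_sumr; apply: eq_bigr => l _; rewrite mulrCA.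
have c0 := continuous_fint (a := 0) Hf Up.
have HD l : holomorphic U (fun q => 'D_(tbase (inr l)) f q) by exact: holomorphic_derive.
have c1 l := continuous_fint (a := 1) (HD l) Up.
pose F (l : 'I_n) t := p.2 0 l * (of_real t ^+ 1 * 'D_(tbase (inr l)) f (fscale t p)).
have Fc l : continuous (F l).
  by move=> t; apply: cvgM; [exact: cvg_cst|exact: c1].
have Sc : continuous (fun t => \sum_l F l t) by exact: continuous_sum.
have gc : continuous g.
  by rewrite gE => t; apply: cvgD; [exact: c0|exact: Sc].
transitivity (cint g).
  rewrite gE (cintD c0 Sc) (cint_sum Fc); congr (_ + _).
  by apply: eq_bigr => l _; rewrite /F (cintZ _ (c1 l)).
pose G (s : C) := s * f ((p.1, s *: p.2) : TE).
rewrite (_ : cint g = G 1 - G 0).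
  rewrite /G mul1r mul0r subr0 scale1r; congr f.
  by rewrite -surjective_pairing.
apply: cint_FTC => // t.
pose L (s : C) : TE := (p.1, s *: p.2).
have LE : L = fun s => (p.1, 0) + s *: ((0, p.2) : TE).
  apply/funext => s; congr pair => /=; first by rewrite scaler0 addr0.
  by rewrite add0r.
have dL (s : C) : is_derive s (1 : C) L (0, p.2) /\ differentiable L s.
  have [d1 D1] := @is_diff_scaleF C C TE id (cst (0, p.2)) s
    (ex_diff (is_diff_def := is_diff_id s)) (differentiable_cst _ _).
  have d2 : differentiable L s.
    by rewrite LE; apply: differentiableD => //; exact: differentiable_cst.
  split=> //; split; first exact: diff_derivable.
  rewrite LE deriveD//; last exact: diff_derivable.
  by rewrite derive_cst add0r D1 derive_cst derive_id scaler0 add0r scale1r.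
have [[_ DL] dLt] := dL (of_real t).
have dfL : differentiable (f \o L) (of_real t).
  exact: (differentiable_comp dLt (dfa _)).
have DfL : 'D_1 (f \o L) (of_real t) = 'D_(0, p.2) f (fscale t p).
  by rewrite (derive_comp (1 : C) dLt (dfa (of_real t))) DL.
have [dG DG] := @is_diff_scaleF C C C id (f \o L) (of_real t)
    (ex_diff (is_diff_def := is_diff_id _)) dfL.
have -> : G = (fun x => id x *: (f \o L) x) by [].
split; first exact: (@diff_derivable _ _ _ _ _ (1 : C) dG).
rewrite [LHS](DG 1) derive_id DfL addrC /g; congr (_ + _).
exact: scale1r.
Qed.

Lemma tcoord_tbase (i j : 'I_n + 'I_n) : tcoord i (tbase j) = (i == j)%:R :> C.
Proof.
case: i j => [i|i] [j|j] /=; rewrite !mxE//= eq_refl/=; congr (_%:R).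
Qed.

Lemma fibre_constant (f : TE -> C) : holomorphic U f ->
  (forall p l, U p -> 'D_(tbase (inr l)) f p = 0) ->
  (forall z, W z -> f (z, 0) = 0) -> forall p, U p -> f p = 0.
Proof.
move=> Hf Df f0 p Up.
pose q (t : R) : TE := (p.1, 0) + of_real t *: ((0, p.2) : TE).
have Uq t : U (q t) by rewrite /U/= scaler0 addr0.
have dq t : differentiable f (q t) := holomorphic_differentiable Hf (Uq t).
have Dq t : 'D_(0, p.2) f (q t) = 0.
  rewrite (derive_tbase _ (dq t)) big1// => -[] l _; last first.
    by rewrite Df// scaler0.
  by rewrite /tcoord/= mxE scale0r.
(* With slope and error both 0, the inequality on the segment from the zero section to [p] is an
   exact equality. *)
have := @mean_value_inequalityC R TE f (p.1, 0) (0, p.2) 0 0.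
have -> : (p.1, 0) + (0, p.2) = p :> TE.
  by rewrite [RHS]surjective_pairing; congr pair; rewrite /= ?addr0 ?add0r.
rewrite f0// mulr0 !subr0 => H; apply/eqP; rewrite -normr_le0; apply: H => t t01.
  exact: (@diff_derivable _ _ _ _ _ _ (dq t)).
by rewrite (Dq t) subr0 normr0.
Qed.

(* The Poincare lemma on the fibres: r l is the coefficient of d theta_l in a
   fibrewise 1-form, which is closed in derive_fibre_primitive. *)
Definition fibre_primitive (r : 'I_n -> TE -> C) (p : TE) : C :=
  \sum_l p.2 0 l * fint 0 (r l) p.

Lemma fibre_primitive0 r z : fibre_primitive r (z, 0) = 0.
Proof. by rewrite /fibre_primitive big1// => l _; rewrite mxE mul0r. Qed.

Lemma holomorphic_tcoord i : holomorphic U (tcoord i : TE -> C).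
Proof.
exact: (holomorphic_ccoord (B := tcoordinates) i (open_fibres Wo)
  (holomorphic_id (open_fibres Wo))).
Qed.

Lemma holomorphic_fibre_primitive r : (forall l, holomorphic U (r l)) ->
  holomorphic U (fibre_primitive r).
Proof.
move=> Hr; apply: holomorphic_sum => [|l _]; first exact: open_fibres.
apply: (holomorphic_scaleF (f := tcoord (inr l))); first exact: open_fibres.
  exact: holomorphic_tcoord.
exact: holomorphic_fint.
Qed.

(** The product rule gives the ray integral of r_m plus the sum over l of theta_l times the integral
    of t D_m r_l. Closedness replaces D_m r_l by D_l r_m, and [fint_euler] for r_m sums up the
    result. *)
Lemma derive_fibre_primitive r p m : (forall l, holomorphic U (r l)) ->
  (forall l m p, U p -> 'D_(tbase (inr l)) (r m) p = 'D_(tbase (inr m)) (r l) p) ->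
  U p -> 'D_(tbase (inr m)) (fibre_primitive r) p = r m p.
Proof.
move=> Hr closed Up.
have dF l : differentiable (fint 0 (r l)) p.
  by have [] := is_diff_fint Wo 0 (Hr l) Up.
have dT l : differentiable (tcoord (inr l) : TE -> C) p.
  exact: (holomorphic_differentiable (holomorphic_tcoord _) Up).
have DF l : 'D_(tbase (inr m)) (fint 0 (r l)) p =
    fint 1 (fun q => 'D_(tbase (inr l)) (r m) q) p.
  rewrite (is_diff_fint Wo 0 (Hr l) Up).2 (bigD1 (inr m))// big1.
    etransitivity; first exact: addr0.
    rewrite tcoord_tbase eqxx mul1r.
    apply: (congr1 cint); apply/funext => t.
    by rewrite (closed m l (fscale t p) Up).
  by move=> i im; rewrite tcoord_tbase (negPf im) mul0r.
have dP l : is_derive p (tbase (inr m)) (fun q => tcoord (inr l) q * fint 0 (r l) q)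
   (p.2 0 l * fint 1 (fun q => 'D_(tbase (inr l)) (r m) q) p + (l == m)%:R * fint 0 (r l) p).
  have [d D] := is_diff_scaleF (dT l) (dF l).
  split; first exact: (@diff_derivable _ _ _ _ _ _ d).
  have DT : 'D_(tbase (inr m)) (tcoord (inr l)) p = (l == m)%:R :> C.
    apply: etrans (derive_ccoord (B := tcoordinates) (inr l) p (tbase (inr m))) _.
    exact: (tcoord_tbase (inr l) (inr m)).
  by rewrite [LHS](D (tbase (inr m))) DF DT.
rewrite -[RHS](fint_euler (Hr m) Up).
have -> : fibre_primitive r = \sum_l (fun q => tcoord (inr l) q * fint 0 (r l) q).
  by apply/funext => q; rewrite /fibre_primitive fct_sumE.
have := is_derive_sum dP => -[_ ->].
rewrite big_split/= addrC; congr (_ + _).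
rewrite (bigD1 m)//= eqxx mul1r big1 ?addr0// => l /negPf ->.
by rewrite mul0r.
Qed.

End FibrePrimitive.

(** * Formal series in a Lie algebra *)

(* ads and exps are ad_series and exp_ad_series in an abstract Lie algebra. *)
Section FormalLieSeries.
Context {K : numFieldType} {L : lmodType K}.
Variable br : L -> L -> L.
Hypothesis br_linearl : forall y, linear (br ^~ y).
Hypothesis br_linearr : forall x, linear (br x).
Hypothesis br_anti : forall x y, br x y = - br y x.
Hypothesis br_jacobi : forall x y z,
  br x (br y z) = br (br x y) z + br y (br x z).

Implicit Types (a b g : nat -> L) (m k : nat).

Lemma brDl (x x' y : L) : br (x + x') y = br x y + br x' y.
Proof. by have := br_linearl y 1 x x'; rewrite !scale1r. Qed.

Lemma brDr (x y y' : L) : br x (y + y') = br x y + br x y'.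
Proof. by have := br_linearr x 1 y y'; rewrite !scale1r. Qed.

Lemma br0l (y : L) : br 0 y = 0.
Proof. by apply: (addrI (br 0 y)); rewrite -brDl !addr0. Qed.

Lemma br0r (x : L) : br x 0 = 0.
Proof. by apply: (addrI (br x 0)); rewrite -brDr !addr0. Qed.

Lemma brZl (k : K) (x y : L) : br (k *: x) y = k *: br x y.
Proof. by have := br_linearl y k x 0; rewrite !addr0 br0l addr0. Qed.

Lemma brZr (k : K) (x y : L) : br x (k *: y) = k *: br x y.
Proof. by have := br_linearr x k y 0; rewrite !addr0 br0r addr0. Qed.

Lemma br_suml (I : Type) (r : seq I) (P : pred I) (F : I -> L) y :
  br (\sum_(i <- r | P i) F i) y = \sum_(i <- r | P i) br (F i) y.
Proof. exact: (big_morph (br ^~ y) (fun x x' => brDl x x' y) (br0l y)). Qed.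

Lemma br_sumr (I : Type) (r : seq I) (P : pred I) (F : I -> L) x :
  br x (\sum_(i <- r | P i) F i) = \sum_(i <- r | P i) br x (F i).
Proof. exact: (big_morph (br x) (brDr x) (br0r x)). Qed.

Definition ads g b : nat -> L :=
  fun m => \sum_(1 <= k < m.+1) br (g k) (b (m - k)%N).

Definition exps g b : nat -> L :=
  fun m => \sum_(k < m.+1) (k`!%:R)^-1 *: iter k (ads g) b m.

(** The bracket of formal series, as a Cauchy product. For two connections, whose index 0 stands for
    order -1, index m of the bracket stands for order m - 2. *)
Definition sbr a b : nat -> L :=
  fun m => \sum_(i < m.+1) br (a i) (b (m - i)%N).

(** Summing over a square whose size does not depend on m, with i + j = m as a condition, lets
    nested Cauchy products be reordered by exchanging sums. *)
Lemma sum_pairs N (F : nat -> nat -> L) m : (m < N)%N ->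
  \sum_(i < m.+1) F i (m - i)%N =
  \sum_(i < N) \sum_(j < N | (i + j == m)%N) F i j.
Proof.
move=> mN; rewrite (big_ord_widen N (fun i => F i (m - i)%N))//.
rewrite big_mkcond/=; apply: eq_bigr => i _; case: ifPn => im; last first.
  rewrite big1// => j /eqP E; move: im; rewrite ltnS -E leq_addr//.
have jN : (m - i < N)%N by rewrite (leq_ltn_trans (leq_subr _ _)).
rewrite (big_pred1 (Ordinal jN))// => j /=; rewrite -val_eqE/=.
by apply/eqP/eqP => [<-|->]; [rewrite addKn|rewrite subnKC].
Qed.

Lemma sbr_pairs N a b m : (m < N)%N ->
  sbr a b m = \sum_(i < N) \sum_(j < N | (i + j == m)%N) br (a i) (b j).
Proof. exact: (sum_pairs (fun i j => br (a i) (b j))). Qed.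

(** Index 0 of a gauge series carries no meaning; setting it to 0 turns [ads] into an instance of
    [sbr], from which it inherits the Leibniz rule. *)
Let pos g : nat -> L := fun k => if k is 0 then 0 else g k.

Lemma ads_sbr g b : ads g b = sbr (pos g) b.
Proof.
apply/funext => m; rewrite /ads /sbr -(big_mkord xpredT (fun i => br (pos g i) (b (m - i)%N))).
rewrite [RHS]big_ltn//= br0l add0r big_nat_cond [RHS]big_nat_cond.
by apply: eq_bigr => -[|k].
Qed.

Lemma sbr_anti a b m : sbr a b m = - sbr b a m.
Proof.
rewrite !(@sbr_pairs m.+1)// (exchange_big_dep xpredT)//= -sumrN; apply: eq_bigr => i _.
rewrite -sumrN; under eq_bigl => j do rewrite addnC.
by apply: eq_bigr => j _; rewrite br_anti.
Qed.

Lemma sbr_leibniz a b c m :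
  sbr a (sbr b c) m = sbr (sbr a b) c m + sbr b (sbr a c) m.
Proof.
pose N := m.+1.
have H3 x y z : sbr x (sbr y z) m =
    \sum_(i < N) \sum_(j < N) \sum_(l < N | (i + (j + l) == m)%N) br (x i) (br (y j) (z l)).
  rewrite (@sbr_pairs N)//; apply: eq_bigr => i _.
  under eq_bigr => j Hj do rewrite (@sbr_pairs N)// br_sumr.
  rewrite exchange_big/=; apply: eq_bigr => j _.
  under eq_bigr => k Hk do rewrite br_sumr.
  rewrite (exchange_big_dep xpredT)//= [RHS]big_mkcond/=; apply: eq_bigr => l _.
  case: ifPn => [/eqP E|E].
    have kN : (j + l < N)%N by rewrite ltnS -E leq_addl.
    rewrite (big_pred1 (Ordinal kN))// => k /=; rewrite -val_eqE/= -E.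
    by rewrite eqn_add2l andb_idl// eq_sym => /eqP ->.
  rewrite big_pred0// => k; apply/negP => /andP[/eqP Ek /eqP Ek'].
  by move: E; rewrite Ek' Ek eqxx.
(* [H3] expands right-nested brackets only; antisymmetry brings this term into that shape. *)
have -> : sbr (sbr a b) c m = - sbr c (sbr a b) m by exact: sbr_anti.
rewrite !H3 [X in - X + _]exchange_big/=.
under [X in - X + _]eq_bigr => i _ do rewrite (exchange_big_dep xpredT)//=.
rewrite [X in _ + X]exchange_big/= -sumrN -big_split/=; apply: eq_bigr => i _.
rewrite -sumrN -big_split/=; apply: eq_bigr => j _.
rewrite -sumrN.
under [X in X + _]eq_bigl => l do rewrite addnC -addnA.
under [X in _ + X]eq_bigl => l do rewrite addnCA.
rewrite -big_split/=; apply: eq_bigr => l _.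
by rewrite br_jacobi (br_anti (br (a i) (b j))).
Qed.

Lemma ads_derivation g a b m :
  ads g (sbr a b) m = sbr (ads g a) b m + sbr a (ads g b) m.
Proof. by rewrite !ads_sbr sbr_leibniz. Qed.

Lemma sbr_suml (I : Type) (r : seq I) (F : I -> nat -> L) b m :
  sbr (fun m => \sum_(i <- r) F i m) b m = \sum_(i <- r) sbr (F i) b m.
Proof.
by rewrite /sbr exchange_big/=; apply: eq_bigr => i _; rewrite br_suml.
Qed.

Lemma sbr_sumr (I : Type) (r : seq I) (F : I -> nat -> L) a m :
  sbr a (fun m => \sum_(i <- r) F i m) m = \sum_(i <- r) sbr a (F i) m.
Proof.
by rewrite /sbr exchange_big/=; apply: eq_bigr => i _; rewrite br_sumr.
Qed.

Lemma sbrZl c a b m : sbr (fun m => c *: a m) b m = c *: sbr a b m.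
Proof. by rewrite /sbr scaler_sumr; apply: eq_bigr => i _; rewrite brZl. Qed.

Lemma sbrZr c a b m : sbr a (fun m => c *: b m) m = c *: sbr a b m.
Proof. by rewrite /sbr scaler_sumr; apply: eq_bigr => i _; rewrite brZr. Qed.

Definition expterm g b k : nat -> L := fun m => (k`!%:R)^-1 *: iter k (ads g) b m.

Lemma exptermS g b k m : k.+1%:R *: expterm g b k.+1 m = ads g (expterm g b k) m.
Proof.
rewrite ads_sbr /expterm sbrZr -ads_sbr scalerA factS natrM invfM mulrA divff.
  by rewrite mul1r.
by rewrite pnatr_eq0.
Qed.

Lemma expterm_vanish g b k m : (m < k)%N -> expterm g b k m = 0.
Proof.
move=> mk; rewrite /expterm; suff -> : iter k (ads g) b m = 0 by rewrite scaler0.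
elim: k m mk => [//|k IH] m mk; rewrite iterS /ads big_nat_cond big1// => j.
rewrite andbT => /andP[j0 jm]; rewrite IH ?br0r//.
rewrite ltn_subLR; last by rewrite -ltnS.
by apply: leq_trans mk _; rewrite -add1n leq_add2r.
Qed.

Lemma exps_widen N g b m : (m < N)%N -> exps g b m = \sum_(k < N) expterm g b k m.
Proof.
move=> mN; rewrite /exps (big_ord_widen N (fun k => expterm g b k m))//.
rewrite [LHS]big_mkcond/=; apply: eq_bigr => k _; case: ifPn => //.
by rewrite -leqNgt => mk; rewrite expterm_vanish.
Qed.

(** The iterated Leibniz rule, with the factorials absorbing the binomial coefficients. In the
    induction k + 1 is split as i + (k + 1 - i), and [exptermS] absorbs each part into one of the
    two factors. *)
Lemma expterm_sbr g a b k m : expterm g (sbr a b) k m =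
  \sum_(i < k.+1) sbr (expterm g a i) (expterm g b (k - i)) m.
Proof.
have X0 c : expterm g c 0 = c.
  by apply/funext => j; rewrite /expterm fact0 invr1 scale1r.
elim: k m => [|k IH] m; first by rewrite big_ord_recl big_ord0 addr0 !X0.
have k0 : k.+1%:R != 0 :> K by rewrite pnatr_eq0.
apply: (scalerI k0); rewrite exptermS.
have -> : expterm g (sbr a b) k =
    fun m => \sum_(i < k.+1) sbr (expterm g a i) (expterm g b (k - i)) m.
  by apply/funext => j; exact: IH.
rewrite ads_sbr sbr_sumr.
under eq_bigr => i _ do rewrite -ads_sbr ads_derivation.
rewrite big_split/= scaler_sumr.
transitivity (\sum_(i < k.+2) (i%:R *: sbr (expterm g a i) (expterm g b (k.+1 - i)) m
   + (k.+1 - i)%:R *: sbr (expterm g a i) (expterm g b (k.+1 - i)) m)); last first.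
  apply: eq_bigr => i _; rewrite -scalerDl -natrD subnKC//.
  by rewrite -ltnS.
rewrite big_split/=; congr (_ + _).
  rewrite [RHS]big_ord_recl scale0r add0r; apply: eq_bigr => i _.
  rewrite -sbrZl/=; congr (sbr _ _ m); apply/funext => j.
  by rewrite /bump leq0n add1n exptermS.
rewrite [RHS]big_ord_recr/= subnn scale0r addr0; apply: eq_bigr => i _.
rewrite -sbrZr subSn//; last by rewrite -ltnS.
by congr (sbr _ _ m); apply/funext => j; rewrite exptermS.
Qed.

Lemma exps_sbr g a b m : sbr (exps g a) (exps g b) m = exps g (sbr a b) m.
Proof.
pose N := m.+1.
transitivity (sbr (fun p => \sum_(i < N) expterm g a i p)
                  (fun p => \sum_(j < N) expterm g b j p) m).
  rewrite /sbr; apply: eq_bigr => i _.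
  by rewrite !(@exps_widen N)// ltnS leq_subr.
rewrite sbr_suml.
under eq_bigr => i _ do rewrite sbr_sumr.
rewrite (@exps_widen N)//.
under [RHS]eq_bigr => k _ do rewrite expterm_sbr
  (@sum_pairs N (fun i j => sbr (expterm g a i) (expterm g b j) m))//.
rewrite [RHS]exchange_big/=; apply: eq_bigr => i _.
rewrite [RHS](exchange_big_dep xpredT)//=; apply: eq_bigr => j _.
have [ijN|Nij] := ltnP (i + j) N.
  apply/esym/(big_pred1 (Ordinal ijN)) => k /=.
  by apply/eqP/eqP => [ijk|->//]; exact: val_inj.
rewrite [RHS]big_pred0 => [|k]; last first.
  by apply/eqP => E; move: Nij; rewrite E leqNgt ltn_ord.
(* For i + j > m every summand vanishes: either p < i, or m - p < j. *)
rewrite /sbr big1// => p _; have [pi|ip] := ltnP p i.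
  by rewrite expterm_vanish// br0l.
rewrite [X in br _ X]expterm_vanish ?br0r//.
rewrite ltn_subLR; last by rewrite -ltnS.
by apply: leq_trans Nij _; rewrite leq_add2r.
Qed.

Lemma exps_commute g a b : (forall m, sbr a b m = 0) ->
  forall m, sbr (exps g a) (exps g b) m = 0.
Proof.
move=> ab0 m; rewrite exps_sbr.
have -> : sbr a b = fun=> 0 by apply/funext.
rewrite /exps big1// => k _.
suff -> : iter k (ads g) (fun=> 0) = fun=> 0 by rewrite scaler0.
elim: (nat_of_ord k) => [//|j /= ->]; apply/funext => i.
by rewrite /ads big1// => l _; rewrite br0r.
Qed.

Lemma iter_ads_ext g g' b k j m : (forall i, (0 < i <= k)%N -> g i = g' i) ->
  (m <= k)%N -> iter j (ads g) b m = iter j (ads g') b m.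
Proof.
move=> gg'; elim: j m => [//|j IH] m mk; rewrite /= /ads.
rewrite big_nat_cond [RHS]big_nat_cond; apply: eq_bigr => i.
rewrite andbT ltnS => /andP[i0 im]; rewrite gg' ?i0 ?(leq_trans im)//.
by rewrite IH// (leq_trans (leq_subr _ _)).
Qed.

Lemma exps_ext g g' b k m : (forall i, (0 < i <= k)%N -> g i = g' i) ->
  (m <= k)%N -> exps g b m = exps g' b m.
Proof.
by move=> gg' mk; apply: eq_bigr => j _; rewrite (@iter_ads_ext g g' b k j m gg' mk).
Qed.

(** In index k + 1 the coefficient of index k + 1 of the gauge series can occur only once, and only
    against [b 0]; hence only the linear term of the exponential sees the change. *)
Lemma exps_step g g' b k : (forall i, (0 < i <= k)%N -> g i = g' i) ->
  exps g b k.+1 - exps g' b k.+1 = br (g k.+1 - g' k.+1) (b 0).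
Proof.
move=> gg'.
have H c c' : (forall m, (m <= k)%N -> c m = c' m) -> c 0 = c' 0 ->
    ads g c k.+1 = ads g' c' k.+1 + br (g k.+1 - g' k.+1) (c 0).
  move=> cc' c0; rewrite /ads big_nat_recr//= [in RHS]big_nat_recr//= !subnn -addrA -c0.
  rewrite -brDl addrCA subrr addr0; congr (_ + _).
  rewrite big_nat_cond [RHS]big_nat_cond; apply: eq_bigr => i.
  rewrite andbT ltnS => /andP[i0 ik]; rewrite gg' ?i0 ?ik//.
  by rewrite cc'// leq_subLR -add1n leq_add2r.
have I j m := @iter_ads_ext g g' b k j m gg'.
rewrite /exps -sumrB big_ord_recl subrr add0r big_ord_recl big1 => [|i _].
  by rewrite !lift0/= addr0 invr1 !scale1r (H b b)// addrAC subrr add0r.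
(* Index 0 is empty after one [ads], so the terms with two or more brackets are unaffected. *)
have c0 f : iter i.+1 (ads f) b 0 = 0 by rewrite /= /ads big_geq.
rewrite !lift0 -scalerBr !iterS (H _ _ (I i.+1)) ?c0// br0r addr0.
by rewrite subrr scaler0.
Qed.

(** All products in index k + 1 except the two extreme ones involve only indices where the series
    agree, and cancel. *)
Lemma sbr_first_difference a a' b b' k :
  (forall m, (m <= k)%N -> a m = a' m) -> (forall m, (m <= k)%N -> b m = b' m) ->
  sbr a b k.+1 = sbr a' b' k.+1 ->
  br (a 0) (b k.+1 - b' k.+1) + br (a k.+1 - a' k.+1) (b 0) = 0.
Proof.
move=> aa' bb'.
have S c d : sbr c d k.+1 = br (c 0) (d k.+1) +
    (\sum_(i < k) br (c i.+1) (d (k - i)%N) + br (c k.+1) (d 0)).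
  rewrite /sbr big_ord_recl subn0 big_ord_recr lift0 subnn.
  by congr (_ + (_ + _)).
rewrite !S -(aa' 0 (leq0n k)) -(bb' 0 (leq0n k)).
have -> : \sum_(i < k) br (a' i.+1) (b' (k - i)%N) =
    \sum_(i < k) br (a i.+1) (b (k - i)%N).
  by apply: eq_bigr => i _; rewrite aa'// bb'// leq_subr.
have brBr x y y' : br x (y - y') = br x y - br x y'.
  by rewrite -scaleN1r brDr brZr scaleN1r.
have brBl x x' y : br (x - x') y = br x y - br x' y.
  by rewrite -scaleN1r brDl brZl scaleN1r.
move=> E; apply/eqP; rewrite brBr brBl addrACA -opprD subr_eq0; apply/eqP.
by move: E; rewrite addrCA [X in _ = X]addrCA => /addrI.
Qed.

(* A pencil x + eps^-1 v which is flat at eps = 1 and eps = -1 is flat at every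
   order in eps. *)
Lemma br_pencil x y v w : br v w = 0 -> br (x + v) (y + w) = 0 ->
  br (x - v) (y - w) = 0 -> br x y = 0 /\ br x w + br v y = 0.
Proof.
have brNl t t' : br (- t) t' = - br t t' by rewrite -scaleN1r brZl scaleN1r.
have brNr t t' : br t (- t') = - br t t' by rewrite -scaleN1r brZr scaleN1r.
move=> vw0.
have -> : br (x + v) (y + w) = br x y + (br x w + br v y).
  by rewrite brDl !brDr vw0 addr0 addrA.
have -> : br (x - v) (y - w) = br x y - (br x w + br v y).
  by rewrite brDl !brDr !brNl !brNr vw0 !oppr0 addr0 opprD addrA.
move: (br x y) (br x w + br v y) => P Q PQ PQ'.
have P0 : P = 0.
  have : 2%:R *: P = 0.
    have -> : 2%:R *: P = (P + Q) + (P - Q).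
      by rewrite addrACA subrr addr0 scaler_nat mulr2n.
    by rewrite PQ PQ' addr0.
  by move/eqP; rewrite scaler_eq0 pnatr_eq0 => /eqP.
by split=> //; move: PQ; rewrite P0 add0r.
Qed.

(** For series eps^-1 v + h, the three bracket conditions are the orders -2, -1 and 0 of the
    curvature. *)
Lemma sbr_two_terms a b : (forall m, a m.+2 = 0) -> (forall m, b m.+2 = 0) ->
  br (a 0) (b 0) = 0 -> br (a 1) (b 0) + br (a 0) (b 1) = 0 ->
  br (a 1) (b 1) = 0 -> forall m, sbr a b m = 0.
Proof.
move=> a2 b2 b00 b01 b11 [|[|[|m]]].
- by rewrite /sbr big_ord_recl big_ord0 addr0.
- by rewrite /sbr !big_ord_recl big_ord0 addr0 addrC.
- by rewrite /sbr !big_ord_recl big_ord0 !addr0 /= b2 a2 br0l br0r b11 !addr0.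
rewrite /sbr big1// => -[[|[|i]] im] _ /=; rewrite ?subn0 ?subSS ?subn0 ?a2 ?b2.
- exact: br0r.
- exact: br0r.
- exact: br0l.
Qed.

End FormalLieSeries.

(** * Lie algebras of holomorphic vector fields *)

(** The Jacobi identity after expansion: [hX], [hY], [hZ] are second derivatives of X, Y, Z along
    the other two fields, already symmetrized, and [a], ..., [f] are the terms differentiating one
    field along a derivative of another. *)
Lemma jacobi_cancel (A : zmodType) (hX hY hZ a b c d e f : A) :
  hZ + a - (hY + b) - (c - d) =
  (a - e - (hY + f - (hX + d))) + (hZ + e - (hX + c) - (b - f)).
Proof.
rewrite !opprB !opprD !addrA.
rewrite [RHS](ACl (7*1*5*12*4*10*(8*2)*(3*9)*(11*6)))%AC/=.
by rewrite !subrr !addr0.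
Qed.

Lemma derive_dir_sum (K : numFieldType) (V W : normedModType K) (J : finType)
  (F : V -> W) (p : V) (a : J -> K) (v : J -> V) : differentiable F p ->
  'D_(\sum_l a l *: v l) F p = \sum_l a l *: 'D_(v l) F p.
Proof.
move=> dF; rewrite deriveE// linear_sum; apply: eq_bigr => l _.
by rewrite linearZ deriveE.
Qed.

Section LieBracket.
Context {R : realType}.
Local Notation C := (Cplx R).
Context {V : normedModType C} (B : coordinates V).
Variables (U : set V) (Uo : open U).
Implicit Types (X Y Z : V -> V) (p u v : V).

Lemma derive_derive_sym {V' : normedModType C} (B' : coordinates V')
  (Z : V -> V') p u v : holomorphic U Z -> U p ->
  'D_u (fun q => 'D_v Z q) p = 'D_v (fun q => 'D_u Z q) p.
Proof.
move=> HZ Up; apply: (ccoord_inj (B := B')) => i.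
have HD w := holomorphic_derive w HZ.
have L w q : U q -> ccoord (c := B') i ('D_w Z q) =
    'D_w (fun q => ccoord (c := B') i (Z q)) q.
  move=> Uq; apply: esym.
  apply: (derive_linear_comp (L := ccoord i)); first exact: continuous_ccoord.
  exact: (holomorphic_differentiable HZ Uq).
have A w w' : ccoord (c := B') i ('D_w (fun q => 'D_w' Z q) p) =
    'D_w (fun q => 'D_w' (fun q => ccoord (c := B') i (Z q)) q) p.
  etransitivity; last exact: (eq_open_derive w Uo (L w') Up).
  apply: esym.
  apply: (derive_linear_comp (L := ccoord i)); first exact: continuous_ccoord.
  exact: (holomorphic_differentiable (HD w') Up).
apply: (etrans (A u v)); apply: (etrans _ (esym (A v u))).
have HT := holomorphic_ccoord (B := B') i Uo HZ.
apply: derive_sym.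
- have := open_nbhs_nbhs (conj Uo Up); apply: filterS => q Uq.
  exact: holomorphic_differentiable HT Uq.
- exact: holomorphic_differentiable (holomorphic_derive u HT) Up.
- exact: holomorphic_differentiable (holomorphic_derive v HT) Up.
Qed.

Lemma derive_derive_dir {W : normedModType C} (Z : V -> W) Y p v :
  holomorphic U Z -> holomorphic U Y -> U p ->
  'D_v (fun q => 'D_(Y q) Z q) p =
  'D_v (fun q => 'D_(Y p) Z q) p + 'D_('D_v Y p) Z p.
Proof.
move=> HZ HY Up.
have dZ q (Uq : U q) := holomorphic_differentiable HZ Uq.
have HD i := holomorphic_derive (cbase (c := B) i) HZ.
have dD i := holomorphic_differentiable (HD i) Up.
have dY i := holomorphic_differentiable (holomorphic_ccoord (B := B) i Uo HY) Up.
have E1 q : U q -> 'D_(Y q) Z q = \sum_i ccoord (c := B) i (Y q) *: 'D_(cbase i) Z q.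
  by move=> Uq; rewrite (derive_cbase B _ (dZ q Uq)).
have E2 q : U q -> 'D_(Y p) Z q = \sum_i ccoord (c := B) i (Y p) *: 'D_(cbase i) Z q.
  by move=> Uq; rewrite (derive_cbase B _ (dZ q Uq)).
have S (a : _ -> V -> C) : (forall i, differentiable (a i) p) ->
   'D_v (fun q => \sum_i a i q *: 'D_(cbase (c := B) i) Z q) p =
   \sum_i (a i p *: 'D_v (fun q => 'D_(cbase i) Z q) p + 'D_v (a i) p *: 'D_(cbase i) Z p).
  move=> da; have H i := is_diff_scaleF (da i) (dD i).
  have [_ Ds] := derive_bigsum (index_enum _) (fun i => (H i).1).
  apply: (etrans (Ds v)).
  by apply: eq_bigr => i _; exact: (H i).2.
have S2 := S (fun i => cst (ccoord i (Y p))) (fun i => differentiable_cst _ _).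
apply: (etrans (etrans (eq_open_derive v Uo E1 Up) (S _ dY))); apply: esym.
apply: (etrans (congr2 +%R (etrans (eq_open_derive v Uo E2 Up) S2)
  (derive_cbase B _ (dZ p Up)))).
rewrite -big_split/=; apply: eq_bigr => i _.
have -> : 'D_v (cst (ccoord (c := B) i (Y p))) p = 0 by exact: derive_cst.
rewrite scale0r addr0; congr (_ + _ *: _).
apply: esym; apply: (derive_linear_comp (L := ccoord i)).
  exact: continuous_ccoord.
exact: (holomorphic_differentiable HY Up).
Qed.

Lemma holomorphic_lie_bracket X Y : holomorphic U X -> holomorphic U Y ->
  holomorphic U (lie_bracket X Y).
Proof.
move=> HX HY.
exact: (holomorphicB Uo (holomorphic_derive_dir B Uo HY HX)
  (holomorphic_derive_dir B Uo HX HY)).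
Qed.

Lemma lie_bracket_anti X Y p : lie_bracket X Y p = - lie_bracket Y X p.
Proof. by rewrite /lie_bracket opprB. Qed.

Lemma derive_lie_bracket X Y p v : holomorphic U X -> holomorphic U Y -> U p ->
  'D_v (lie_bracket X Y) p =
  'D_v (fun q => 'D_(X p) Y q) p + 'D_('D_v X p) Y p -
  ('D_v (fun q => 'D_(Y p) X q) p + 'D_('D_v Y p) X p).
Proof.
move=> HX HY Up.
have H1 := holomorphic_differentiable (holomorphic_derive_dir B Uo HY HX) Up.
have H2 := holomorphic_differentiable (holomorphic_derive_dir B Uo HX HY) Up.
rewrite -(derive_derive_dir v HY HX Up) -(derive_derive_dir v HX HY Up).
exact: deriveB (@diff_derivable _ _ _ _ _ v H1) (@diff_derivable _ _ _ _ _ v H2).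
Qed.

Lemma derive_dirB {W : normedModType C} (F : V -> W) p u v : differentiable F p ->
  'D_(u - v) F p = 'D_u F p - 'D_v F p.
Proof. by move=> dF; rewrite !deriveE// linearB. Qed.

Lemma lie_bracket_jacobi X Y Z p : holomorphic U X -> holomorphic U Y ->
  holomorphic U Z -> U p ->
  lie_bracket X (lie_bracket Y Z) p =
  lie_bracket (lie_bracket X Y) Z p + lie_bracket Y (lie_bracket X Z) p.
Proof.
move=> HX HY HZ Up.
have dX := holomorphic_differentiable HX Up.
have dY := holomorphic_differentiable HY Up.
have dZ := holomorphic_differentiable HZ Up.
have D1 := derive_lie_bracket (X p) HY HZ Up.
have D2 := derive_lie_bracket (Z p) HX HY Up.
have D3 := derive_lie_bracket (Y p) HX HZ Up.
rewrite {1}/lie_bracket D1 {2}/lie_bracket D2 {3}/lie_bracket D3.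
rewrite /lie_bracket (derive_dirB _ _ dX) (derive_dirB _ _ dZ) (derive_dirB _ _ dY).
rewrite (derive_derive_sym B (X p) (Y p) HZ Up).
rewrite (derive_derive_sym B (X p) (Z p) HY Up) (derive_derive_sym B (Y p) (Z p) HX Up).
exact: jacobi_cancel.
Qed.

(** Brackets of T-related fields are T-related; the coefficients [c l] come out of the bracket
    because [g] differentiates them to 0. *)
Lemma lie_bracket_related {V' : normedModType C} (B' : coordinates V') (J : finType)
    (U' : set V') (T : V -> V') (g b : V -> V) (g' : V' -> V') (b' : J -> V' -> V')
    (c : J -> V -> C) : (forall p, U p -> U' (T p)) ->
  holomorphic U T -> holomorphic U g -> holomorphic U b ->
  holomorphic U' g' -> (forall l, holomorphic U' (b' l)) ->
  (forall l p, U p -> differentiable (c l) p /\ 'D_(g p) (c l) p = 0) ->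
  (forall p, U p -> 'D_(g p) T p = g' (T p)) ->
  (forall p, U p -> 'D_(b p) T p = \sum_l c l p *: b' l (T p)) ->
  forall p, U p -> 'D_(lie_bracket g b p) T p =
    \sum_l c l p *: lie_bracket g' (b' l) (T p).
Proof.
move=> UU' HT Hg Hb Hg' Hb' Hc gT bT p Up.
have dT := holomorphic_differentiable HT Up.
have dg' := holomorphic_differentiable Hg' (UU' p Up).
have db' l := holomorphic_differentiable (Hb' l) (UU' p Up).
have dbT l := differentiable_comp dT (db' l).
have E1 := etrans (esym (derive_derive_dir (b p) HT Hg Up))
  (etrans (eq_open_derive (b p) Uo gT Up) (derive_comp (b p) dT dg')).
have E2 := etrans (esym (derive_derive_dir (g p) HT Hb Up))
  (eq_open_derive (g p) Uo bT Up).
have H l := is_diff_scaleF (Hc l p Up).1 (dbT l).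
have [_ Ds] := derive_bigsum (index_enum _) (fun l => (H l).1).
rewrite /lie_bracket (derive_dirB _ _ dT).
have S := derive_derive_sym B' (b p) (g p) HT Up.
(* [h] is the second derivative of [T] along [g p] and [b p]; by symmetry it appears in both halves
   of the bracket and cancels. *)
set h := 'D_(b p) _ p in S E1; rewrite -S in E2.
have {}E2 := etrans E2 (Ds (g p)).
have -> : 'D_('D_(g p) b p) T p =
    \sum_l c l p *: 'D_(g' (T p)) (b' l) (T p) - h.
  apply: (addrI h); rewrite E2 addrC subrK; apply: eq_bigr => l _.
  rewrite (H l).2 (Hc l p Up).2 scale0r addr0.
  by rewrite (derive_comp (g p) dT (db' l)) gT.
have -> : 'D_('D_(b p) g p) T p =
    \sum_l c l p *: 'D_(b' l (T p)) g' (T p) - h.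
  by apply: (addrI h); rewrite E1 bT// (derive_dir_sum _ _ dg') addrC subrK.
rewrite opprB addrA subrK -sumrB.
by apply: eq_bigr => l _; rewrite scalerBr.
Qed.

End LieBracket.

Section HolomorphicFields.
Context {R : realType}.
Local Notation C := (Cplx R).
Context {V : normedModType C}.

Definition field_on (U : set V) : {pred V -> V} :=
  fun f => `[< holomorphic U f /\ forall p, ~ U p -> f p = 0 >].

Lemma field_onP (U : set V) (f : V -> V) :
  reflect (holomorphic U f /\ forall p, ~ U p -> f p = 0) (f \in field_on U).
Proof. exact: asboolP. Qed.

(* Two vector fields which agree on U are identified by extending them by 0
   outside of U, so that the fields on U form a genuine Lie algebra. *)
Record hfield (U : set V) (Uo : open U) := HField {
  hval :> V -> V;
  hvalP : hval \in field_on U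
}.

Context (U : set V) (Uo : open U).

HB.instance Definition _ := [isSub for @hval U Uo].
HB.instance Definition _ := [Choice of hfield Uo by <:].

Lemma field_on_submod : submod_closed (field_on U).
Proof.
split=> [|a f g /field_onP[Hf f0] /field_onP[Hg g0]]; apply/field_onP.
  by split=> //; exact: holomorphic_cst.
split=> [|p Up]; last by rewrite /= -[LHS]/(a *: f p + g p) f0// g0// scaler0 addr0.
exact: (holomorphicD Uo (holomorphicZ a Uo Hf) Hg).
Qed.

HB.instance Definition _ := GRing.SubChoice_isSubLmodule.Build
  C (V -> V) (field_on U) (hfield Uo) field_on_submod.

Lemma hval_holomorphic (X : hfield Uo) : holomorphic U X.
Proof. by have /field_onP[] := hvalP X. Qed.

Lemma hfield_eq (X Y : hfield Uo) : (forall p, U p -> X p = Y p) -> X = Y.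
Proof.
move=> XY; apply: val_inj; apply/funext => p /=.
have [Up|Up] := pselect (U p); first exact: XY.
by have /field_onP[_ ->//] := hvalP X; have /field_onP[_ ->] := hvalP Y.
Qed.

Lemma hval_sum (I : Type) (r : seq I) (F : I -> hfield Uo) p :
  (\sum_(i <- r) F i) p = \sum_(i <- r) F i p.
Proof. by elim/big_rec2: _ => [//|i _ X _ <-]. Qed.

Lemma restrict_field_on (f : V -> V) : holomorphic U f ->
  (fun p => if p \in U then f p else 0) \in field_on U.
Proof.
move=> Hf; apply/field_onP; split=> [|p Up]; last by rewrite memNset.
by apply: eq_holomorphic Uo _ Hf => p Up; rewrite mem_set.
Qed.

Definition hrestrict (f : V -> V) (Hf : holomorphic U f) : hfield Uo :=
  HField Uo (restrict_field_on Hf).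

Lemma hrestrictE (f : V -> V) (Hf : holomorphic U f) p : U p -> hrestrict Hf p = f p.
Proof. by move=> Up /=; rewrite mem_set. Qed.

Lemma eq_lie_bracket (X X' Y Y' : V -> V) p : (forall q, U q -> X q = X' q) ->
  (forall q, U q -> Y q = Y' q) -> U p -> lie_bracket X Y p = lie_bracket X' Y' p.
Proof.
move=> XX YY Up; rewrite /lie_bracket XX// YY//; congr (_ - _).
  exact: eq_open_derive Up.
exact: eq_open_derive Up.
Qed.

Variable B : coordinates V.

Definition hbracket (X Y : hfield Uo) : hfield Uo :=
  hrestrict (holomorphic_lie_bracket B Uo (hval_holomorphic X) (hval_holomorphic Y)).

Lemma hbracketE (X Y : hfield Uo) p : U p -> hbracket X Y p = lie_bracket X Y p.
Proof. exact: hrestrictE. Qed.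

Lemma hbracket_linearr (X : hfield Uo) : linear (hbracket X).
Proof.
move=> a Y Z; apply: hfield_eq => p Up.
rewrite -[RHS]/(a *: hbracket X Y p + hbracket X Z p) !hbracketE//.
have dX := holomorphic_differentiable (hval_holomorphic X) Up.
have dY := holomorphic_differentiable (hval_holomorphic Y) Up.
have dZ := holomorphic_differentiable (hval_holomorphic Z) Up.
have d v : 'D_v (hval (a *: Y + Z)) p = a *: 'D_v Y p + 'D_v Z p.
  have -> : hval (a *: Y + Z) = (fun q => a *: Y q) + Z :> (V -> V) by [].
  have dv F : differentiable F p -> derivable F p v := @diff_derivable _ V V F p v.
  rewrite deriveD; [|exact/dv/differentiableZ|exact: dv].
  by rewrite deriveZ//; exact: dv.
rewrite /lie_bracket d.
have -> : 'D_((a *: Y + Z) p) X p = a *: 'D_(Y p) X p + 'D_(Z p) X p.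
  by rewrite -derive_dirZ// -derive_dirD.
by rewrite scalerBr opprD addrACA.
Qed.

Lemma hbracket_anti (X Y : hfield Uo) : hbracket X Y = - hbracket Y X.
Proof.
apply: hfield_eq => p Up; rewrite -[RHS]/(- hbracket Y X p) !hbracketE//.
exact: lie_bracket_anti.
Qed.

Lemma hbracket_linearl (Y : hfield Uo) : linear (hbracket ^~ Y).
Proof.
move=> a X Z; rewrite hbracket_anti hbracket_linearr opprD.
by rewrite -scalerN -!hbracket_anti.
Qed.

Lemma hbracket_jacobi (X Y Z : hfield Uo) : hbracket X (hbracket Y Z) =
  hbracket (hbracket X Y) Z + hbracket Y (hbracket X Z).
Proof.
apply: hfield_eq => p Up.
rewrite -[RHS]/(hbracket (hbracket X Y) Z p + hbracket Y (hbracket X Z) p).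
have E (A D : hfield Uo) q (Uq : U q) := hbracketE A D Uq.
rewrite !E// (eq_lie_bracket (fun _ _ => erefl) (E Y Z) Up).
rewrite (eq_lie_bracket (E X Y) (fun _ _ => erefl) Up).
rewrite (eq_lie_bracket (fun _ _ => erefl) (E X Z) Up).
by apply: lie_bracket_jacobi Up => //; exact: hval_holomorphic.
Qed.

Lemma exp_ad_series_hfield (g b : nat -> hfield Uo) (g0 b0 : nat -> V -> V) :
  (forall k p, (0 < k)%N -> U p -> g0 k p = g k p) ->
  (forall m p, U p -> b0 m p = b m p) ->
  forall m p, U p -> exp_ad_series g0 b0 m p = exps hbracket g b m p.
Proof.
move=> g0g b0b m p Up; rewrite /exp_ad_series /exps hval_sum.
apply: eq_bigr => k _; rewrite -[RHS]/(_ *: (iter k (ads hbracket g) b m) p).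
congr (_ *: _); move: {k}(nat_of_ord k) => k.
elim: k m p Up => [|k IH] m p Up; first exact: b0b.
rewrite /= /ad_series /ads hval_sum big_nat_cond [RHS]big_nat_cond.
apply: eq_bigr => j; rewrite andbT => /andP[j0 _]; rewrite hbracketE//.
apply: eq_lie_bracket Up => q Uq; first exact: g0g.
exact: IH.
Qed.

(** The default value 0 makes this total in [f], so that series of fields need not carry proofs of
    holomorphy. *)
Definition tohf (f : V -> V) : hfield Uo :=
  match pselect (holomorphic U f) with
  | left Hf => hrestrict Hf
  | right _ => 0
  end.

Lemma tohfE (f : V -> V) p : holomorphic U f -> U p -> tohf f p = f p.
Proof. by move=> Hf Up; rewrite /tohf; case: pselect => // H; exact: hrestrictE. Qed.

Lemma iter_ad_series_hfield (g b : nat -> V -> V) :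
  (forall k, (0 < k)%N -> holomorphic U (g k)) -> (forall m, holomorphic U (b m)) ->
  forall k m p, U p -> iter k (ad_series g) b m p =
    iter k (ads hbracket (fun j => tohf (g j))) (fun j => tohf (b j)) m p.
Proof.
move=> Hg Hb; elim=> [|k IH] m p Up; first by rewrite /= tohfE.
rewrite /= /ad_series /ads hval_sum big_nat_cond [RHS]big_nat_cond.
apply: eq_bigr => j; rewrite andbT => /andP[j0 _]; rewrite hbracketE//.
apply: eq_lie_bracket Up => q Uq; first by rewrite tohfE//; exact: Hg.
exact: IH.
Qed.

Lemma holomorphic_iter_ad_series (g b : nat -> V -> V) :
  (forall k, (0 < k)%N -> holomorphic U (g k)) -> (forall m, holomorphic U (b m)) ->
  forall k m, holomorphic U (iter k (ad_series g) b m).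
Proof.
move=> Hg Hb k m; apply: eq_holomorphic Uo _ (hval_holomorphic
  (iter k (ads hbracket (fun j => tohf (g j))) (fun j => tohf (b j)) m)) => p Up.
by rewrite (iter_ad_series_hfield Hg Hb).
Qed.

(** [L] is constant on each [b m] and zero on each [g k], so the derivatives of these fields, and
    with them all brackets, are killed by [L]. With [L] the projection to the base, vertical gauge
    fields do not alter the base part of a connection. *)
Lemma linear_exp_ad_series {W : normedModType C} (L : {linear V -> W})
    (g b : nat -> V -> V) (w : nat -> W) : continuous L ->
  (forall k, (0 < k)%N -> holomorphic U (g k)) -> (forall m, holomorphic U (b m)) ->
  (forall k p, (0 < k)%N -> U p -> L (g k p) = 0) ->
  (forall m p, U p -> L (b m p) = w m) ->
  forall m p, U p -> L (exp_ad_series g b m p) = w m.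
Proof.
move=> Lc Hg Hb Lg Lb m p Up.
have I0 k : forall m p, U p -> L (iter k (ad_series g) b m p) = if k is 0 then w m else 0.
  elim: k => [|k IH] {}m {}p {}Up; first exact: Lb.
  rewrite /= /ad_series linear_sum big_nat_cond big1// => j.
  rewrite andbT => /andP[j0 _].
  have D0 (F : V -> V) (x : W) v : holomorphic U F -> (forall q, U q -> L (F q) = x) ->
      L ('D_v F p) = 0.
    move=> HF FE.
    rewrite -(derive_linear_comp v Lc (holomorphic_differentiable HF Up)).
    by rewrite (eq_open_derive (g := cst x) v Uo FE Up) derive_cst.
  have Hi := holomorphic_iter_ad_series Hg Hb k (m - j).
  rewrite /lie_bracket linearB (D0 (g j) 0 _ (Hg j j0) (fun q => Lg j q j0)).
  by rewrite (D0 _ _ _ Hi (IH (m - j)%N)) subrr.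
rewrite linear_sum big_ord_recl big1 ?addr0 => [|k _].
  rewrite fact0 invr1 scale1r; exact: (I0 0%N).
by rewrite lift0 linearZ (I0 k.+1 m p Up)/= scaler0.
Qed.

End HolomorphicFields.

Lemma derive_dir_bigsum (K : numFieldType) (V W : normedModType K) (I : Type)
  (r : seq I) (P : pred I) (v : I -> V) (F : V -> W) (p : V) :
  differentiable F p ->
  'D_(\sum_(i <- r | P i) v i) F p = \sum_(i <- r | P i) 'D_(v i) F p.
Proof.
move=> dF; rewrite deriveE// linear_sum; apply: eq_bigr => i _.
by rewrite deriveE.
Qed.

Section RelatedSeries.
Context {R : realType}.
Local Notation C := (Cplx R).
Context {V V' : normedModType C} (B : coordinates V) (B' : coordinates V').
Variables (U : set V) (Uo : open U) (U' : set V') (Uo' : open U').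

(* Used with T a change of charts and c its Jacobian, and with T the identity,
   where it says that the gauge action of vertical fields is linear over the
   functions on M. *)
Lemma exp_ad_series_related (J : finType) (T : V -> V')
    (g b : nat -> V -> V) (g' : nat -> V' -> V')
    (b' : J -> nat -> V' -> V') (c : J -> V -> C) :
  (forall p, U p -> U' (T p)) -> holomorphic U T ->
  (forall k, (0 < k)%N -> holomorphic U (g k)) -> (forall m, holomorphic U (b m)) ->
  (forall k, (0 < k)%N -> holomorphic U' (g' k)) ->
  (forall l m, holomorphic U' (b' l m)) ->
  (forall k l p, (0 < k)%N -> U p ->
    differentiable (c l) p /\ 'D_(g k p) (c l) p = 0) ->
  (forall k p, (0 < k)%N -> U p -> 'D_(g k p) T p = g' k (T p)) ->
  (forall m p, U p -> 'D_(b m p) T p = \sum_l c l p *: b' l m (T p)) ->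
  forall m p, U p -> 'D_(exp_ad_series g b m p) T p =
    \sum_l c l p *: exp_ad_series g' (b' l) m (T p).
Proof.
move=> UU' HT Hg Hb Hg' Hb' Hc gT bT m p Up.
have dT q (Uq : U q) := holomorphic_differentiable HT Uq.
have Ik k : forall m p, U p -> 'D_(iter k (ad_series g) b m p) T p =
    \sum_l c l p *: iter k (ad_series g') (b' l) m (T p).
  elim: k => [|k IH] {}m {}p {}Up; first exact: bT.
  rewrite /= /ad_series (derive_dir_bigsum _ _ _ (dT p Up)).
  under [RHS]eq_bigr => l _ do rewrite scaler_sumr.
  rewrite [RHS]exchange_big/= big_nat_cond [RHS]big_nat_cond.
  apply: eq_bigr => j; rewrite andbT => /andP[j0 _].
  have Hi := holomorphic_iter_ad_series Uo B Hg Hb k (m - j).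
  have Hi' l := holomorphic_iter_ad_series Uo' B' Hg' (Hb' l) k (m - j).
  exact: (@lie_bracket_related R V B U Uo V' B' J U' T (g j) _ (g' j)
    (fun l => iter k (ad_series g') (b' l) (m - j)%N) c UU' HT (Hg j j0) Hi
    (Hg' j j0) Hi' (fun l q => Hc j l q j0) (fun q => gT j q j0) (IH (m - j)%N) p Up).
rewrite /exp_ad_series (derive_dir_bigsum _ _ _ (dT p Up)).
under [RHS]eq_bigr => l _ do rewrite scaler_sumr.
rewrite [RHS]exchange_big/=; apply: eq_bigr => k _.
rewrite (derive_dirZ _ _ (dT p Up)) Ik// scaler_sumr.
by apply: eq_bigr => l _; rewrite !scalerA mulrC.
Qed.

End RelatedSeries.

(** * Charts and connections *)

(** Only the restriction to one line matters: the difference quotient is constant there. Applied to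
    expressions linear in the fibre coordinate or constant along it. *)
Lemma derive_affine (K : numFieldType) (V W : normedModType K) (f : V -> W)
  (p v : V) (w : W) : (forall s : K, f (s *: v + p) = f p + s *: w) ->
  'D_v f p = w.
Proof.
move=> H; rewrite /derive; apply/lim_near_cst => //.
near=> s; rewrite /= H addrC addKr scalerA mulVf ?scale1r//.
by near: s; exact: nbhs_dnbhs_neq.
Unshelve. all: by end_near. Qed.

Section FlatCoordinates.
Context {R : realType} {n : nat}.
Local Notation C := (Cplx R).
Local Notation E := ('rV[C]_n).
Local Notation TE := (E * E)%type.

Definition ecoord (j : 'I_n) (x : E) : C := x 0 j.

Lemma ecoord_linear j : linear (ecoord j : E -> C).
Proof. by move=> a x y; rewrite /ecoord !mxE. Qed.

HB.instance Definition _ j :=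
  GRing.isLinear.Build C E C *:%R (ecoord j) (ecoord_linear j).

Definition ebase (j : 'I_n) : E := delta_mx 0 j.

Lemma ebase_sum (x : E) : x = \sum_j ecoord j x *: ebase j.
Proof. exact: row_sum_delta. Qed.

Lemma continuous_ecoord j : continuous (ecoord j).
Proof. exact: coord_continuous. Qed.

Definition ecoordinates : coordinates E :=
  Coordinates (ccoord := fun j => ecoord j : {linear E -> C})
    continuous_ecoord ebase_sum.

Lemma tfst_linear : linear (fst : TE -> E). Proof. by []. Qed.
Definition tfst : {linear TE -> E} :=
  HB.pack (fst : TE -> E) (GRing.isLinear.Build C TE E *:%R fst tfst_linear).
Lemma continuous_tfst : continuous tfst.
Proof. by move=> p; exact: cvg_fst. Qed.

Lemma tsnd_linear : linear (snd : TE -> E). Proof. by []. Qed.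
Definition tsnd : {linear TE -> E} :=
  HB.pack (snd : TE -> E) (GRing.isLinear.Build C TE E *:%R snd tsnd_linear).
Lemma continuous_tsnd : continuous tsnd.
Proof. by move=> p; exact: cvg_snd. Qed.

Lemma holomorphic_basic {W : normedModType C} (A : set E) (f : E -> W) : open A ->
  holomorphic A f -> holomorphic [set p : TE | A p.1] (fun p => f p.1).
Proof. by move=> Ao Hf; exact: (holomorphic_comp_linear (L := tfst) Ao continuous_tfst Hf). Qed.

End FlatCoordinates.

Section Charts.
Context {R : realType} {n : nat} (M : complex_manifold R n).
Local Notation C := (Cplx R).
Local Notation E := ('rV[C]_n).
Local Notation TE := (E * E)%type.
Implicit Types (i j : chart_index M) (p : TE) (x y z : E).

Lemma open_timg i : open (timg i).
Proof. exact: (@open_fibres R n (img i) (@img_open R n M i)). Qed.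

Lemma overlapE i j : overlap i j = [set z | img i z /\ dom j (chart_inv i z)].
Proof.
apply/seteqP; split=> [z [q [iq jq] <-]|z [[q iq <-]]] /=.
  by split; [exists q|rewrite chartK].
by rewrite chartK// => jq; exists q.
Qed.

Lemma open_overlap i j : open (overlap i j).
Proof.
rewrite openE => z; rewrite overlapE => -[iz jz].
have ci : {for z, continuous (chart_inv i)} := chart_inv_continuous iz.
have n1 : nbhs z (img i) by apply: open_nbhs_nbhs; split=> //; exact: (@img_open R n M).
have n2 : nbhs z (chart_inv i @^-1` dom j).
  by apply: ci; apply: open_nbhs_nbhs; split=> //; exact: (@dom_open R n M).
exact: filterI n1 n2.
Qed.

Lemma overlap_img i j z : overlap i j z -> img i z.
Proof. by rewrite overlapE => -[]. Qed.

Lemma overlap_tau i j z : overlap i j z -> img j (tau i j z).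
Proof. by rewrite overlapE => -[iz jz]; exists (chart_inv i z). Qed.

Lemma differentiable_tau i j z : overlap i j z -> differentiable (tau i j) z.
Proof. exact: (holomorphic_differentiable (@transition_holomorphic R n M i j)). Qed.

Lemma derive_Ttau_vertical i j p y : overlap i j p.1 ->
  'D_(0, y) (Ttau i j) p = (0, 'D_y (tau i j) p.1).
Proof.
move=> op; have dt := differentiable_tau op.
apply: derive_affine => s; rewrite /Ttau/= scaler0 add0r.
rewrite (derive_dirD _ _ dt) (derive_dirZ _ _ dt).
by congr pair => /=; rewrite ?scaler0 ?addr0// addrC.
Qed.

Definition tover i j : set TE := [set p | overlap i j p.1].

Lemma open_tover i j : open (tover i j).
Proof. exact: (open_fibres (@open_overlap i j)). Qed.

Lemma holomorphic_Ttau i j : holomorphic (tover i j) (Ttau i j).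
Proof.
have Uo := @open_tover i j.
have Ht := @transition_holomorphic R n M i j.
have Hc (f : E -> E) k : holomorphic (overlap i j) f ->
    holomorphic (tover i j) (fun p => ecoord k (f p.1)).
  move=> Hf.
  exact: (@holomorphic_basic R n C (overlap i j) (fun z => ecoord k (f z))
    (@open_overlap i j)
    (holomorphic_ccoord (B := ecoordinates) k (@open_overlap i j) Hf)).
apply: (holomorphic_coordinates (B := tcoordinates) Uo) => -[] k.
  exact: Hc.
(* The fibre part differentiates [tau i j] in a direction that varies with the point; expanding
   theta leaves fixed directions with coefficients theta_l. *)
apply: (eq_holomorphic (f := fun p => \sum_l tcoord (inr l) p *:
   ecoord k ('D_(ebase l) (tau i j) p.1)) Uo).
  move=> p op /=; rewrite -[RHS]/(ecoord k ('D_(p.2) (tau i j) p.1)).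
  rewrite (derive_cbase ecoordinates _ (differentiable_tau op)) linear_sum.
  by apply: eq_bigr => l _; rewrite linearZ.
apply: holomorphic_sum => // l _; apply: holomorphic_scaleF => //.
  exact: (holomorphic_tcoord (@open_overlap i j) (inr l)).
exact: (Hc (fun z => 'D_(ebase l) (tau i j) z) k (holomorphic_derive (ebase l) Ht)).
Qed.

Lemma Ttau_fscale i j t p : overlap i j p.1 ->
  Ttau i j (fscale t p) = fscale t (Ttau i j p).
Proof.
by move=> op; rewrite /Ttau /fscale/= (derive_dirZ _ _ (differentiable_tau op)).
Qed.

Section Connections.
Variable h : connection M.

Lemma hlift0 i p : timg i p -> h i 0 p = 0.
Proof.
move=> ip; apply: (addrI (h i 0 p)).
by have := hlift_linear h ip 1 0 0; rewrite !scale1r !addr0.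
Qed.

Lemma hlift_sum i p x : timg i p -> h i x p = \sum_l ecoord l x *: h i (ebase l) p.
Proof.
move=> ip; rewrite {1}(ebase_sum x).
elim: (index_enum _) => [|l r IH]; first by rewrite !big_nil hlift0.
by rewrite !big_cons hlift_linear// IH.
Qed.

Lemma holomorphic_formal i A X m : local_field i A X ->
  holomorphic [set p | A p.1] (formal_connection h i X m).
Proof.
move=> [Ao Ai HX]; have Uo := open_fibres Ao.
have HXc l : holomorphic [set p | A p.1] (fun p => ecoord l (X p.1)).
  exact: (@holomorphic_basic R n C A (fun z => ecoord l (X z)) Ao
    (holomorphic_ccoord (B := ecoordinates) l Ao HX)).
case: m => [|[|m]]; last exact: holomorphic_cst.
  apply: (eq_holomorphic (f := fun p => \sum_l ecoord l (X p.1) *: ((0, ebase l) : TE)) Uo).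
    move=> p _; rewrite [RHS]/lift_field/= /vlift {2}(ebase_sum (X p.1)).
    by elim/big_rec2: _ => // l u v _ ->; congr pair; rewrite /= scaler0 addr0.
  apply: holomorphic_sum => // l _; apply: holomorphic_scaleF => //.
  exact: holomorphic_cst.
apply: (eq_holomorphic (f := fun p => \sum_l ecoord l (X p.1) *: h i (ebase l) p) Uo).
  by move=> p Ap; rewrite /= /lift_field -hlift_sum//; exact: Ai.
apply: holomorphic_sum => // l _; apply: holomorphic_scaleF => //.
apply: holomorphic_sub (hlift_holomorphic h i (ebase l)) => p; exact: Ai.
Qed.

Lemma local_field_cst i x : local_field i (img i) (cst x).
Proof. by split; [exact: (@img_open R n M)|by []|exact: holomorphic_cst]. Qed.

Lemma holomorphic_formal_cst i x m :
  holomorphic (timg i) (formal_connection h i (cst x) m).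
Proof. exact: (holomorphic_formal m (local_field_cst i x)). Qed.

Lemma formal_connection_sum i X m p : timg i p -> formal_connection h i X m p =
  \sum_l ecoord l (X p.1) *: formal_connection h i (cst (ebase l)) m p.
Proof.
move=> ip; case: m => [|[|m]] /=.
- rewrite /lift_field/= /vlift {1}(ebase_sum (X p.1)).
  by elim/big_rec2: _ => // l u v _ <-; congr pair; rewrite /= scaler0 addr0.
- exact: hlift_sum.
- by rewrite big1// => l _; rewrite scaler0.
Qed.

Lemma formal_connection_compat i j x m p : overlap i j p.1 ->
  'D_(formal_connection h i (cst x) m p) (Ttau i j) p =
  \sum_l ecoord l ('D_x (tau i j) p.1) *:
    formal_connection h j (cst (ebase l)) m (Ttau i j p).
Proof.
move=> op; have jTp : timg j (Ttau i j p) := overlap_tau op.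
rewrite -(formal_connection_sum (fun=> 'D_x (tau i j) p.1) m jTp).
case: m => [|[|m]] /=.
- exact: derive_Ttau_vertical.
- exact: hlift_compat.
- exact: derive0.
Qed.

End Connections.

End Charts.

Lemma derive_pair (K : numFieldType) (U V W : normedModType K) (f : U -> V)
  (g : U -> W) (x v : U) : differentiable f x -> differentiable g x ->
  'D_v (fun y => (f y, g y)) x = ('D_v f x, 'D_v g x).
Proof.
move=> df dg; rewrite deriveE; last exact: differentiable_pair.
by rewrite diff_pair// !deriveE.
Qed.

(** * Flatness as an identity of formal series, and absence of torsion *)

Section FlatConnections.
Context {R : realType} {n : nat} (M : complex_manifold R n).
Local Notation C := (Cplx R).
Local Notation E := ('rV[C]_n).
Local Notation TE := (E * E)%type.
Implicit Types (i : chart_index M) (p : TE) (x y : E) (h : connection M).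

Definition cbracket i : hfield (@open_timg R n M i) -> hfield (@open_timg R n M i) ->
  hfield (@open_timg R n M i) := hbracket tcoordinates.

Definition cfield i (f : TE -> TE) : hfield (@open_timg R n M i) :=
  tohf (@open_timg R n M i) f.

Lemma cfieldE i f p : holomorphic (timg i) f -> timg i p -> cfield i f p = f p.
Proof. exact: tohfE. Qed.

Lemma cbracketE i f g p : holomorphic (timg i) f -> holomorphic (timg i) g ->
  timg i p -> cbracket (cfield i f) (cfield i g) p = lie_bracket f g p.
Proof.
move=> Hf Hg ip; apply: (etrans (hbracketE tcoordinates _ _ ip)).
exact: (eq_lie_bracket (@open_timg R n M i) (fun q iq => cfieldE Hf iq)
  (fun q iq => cfieldE Hg iq) ip).
Qed.

Definition cseries h i l m := cfield i (formal_connection h i (cst (ebase l)) m).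

(** Coordinate fields suffice: they commute, so no term for [X, Y] appears, and
    [formal_connection_sum] expresses every other lift through theirs. *)
Definition formally_flat h := forall i l l' m,
  sbr (@cbracket i) (cseries h i l) (cseries h i l') m = 0.

Lemma lie_bracket_cst (V : normedModType C) (u v p : V) :
  lie_bracket (cst u) (cst v) p = 0.
Proof. by rewrite /lie_bracket !derive_cst subrr. Qed.

(** Orders 0 and -1 are what has to be checked: in order -2 the vertical lifts of coordinate fields
    are constant and commute. *)
Lemma formally_flatP h :
  (forall i x y p, timg i p -> lie_bracket (h i x) (h i y) p = 0 /\
    lie_bracket (h i x) (vlift i y) p + lie_bracket (vlift i x) (h i y) p = 0) ->
  formally_flat h.
Proof.
move=> Hh i l l'.
have H l0 m := holomorphic_formal_cst h i (ebase l0) m.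
have z l0 m : cseries h i l0 m.+2 = 0.
  by apply: hfield_eq => p ip; rewrite cfieldE//; exact: H.
apply: sbr_two_terms.
- exact: hbracket_linearl.
- exact: hbracket_linearr.
- exact: z.
- exact: z.
- apply: hfield_eq => p ip; rewrite cbracketE//.
  exact: lie_bracket_cst.
- apply: hfield_eq => p ip.
  rewrite -[LHS]/(cbracket (cseries h i l 1) (cseries h i l' 0) p +
    cbracket (cseries h i l 0) (cseries h i l' 1) p).
  rewrite !cbracketE//.
  exact: (Hh i (ebase l) (ebase l') p ip).2.
- apply: hfield_eq => p ip; rewrite cbracketE//.
  exact: (Hh i (ebase l) (ebase l') p ip).1.
Qed.

Lemma flat_cst (A : chart_index M -> E -> TE -> TE) i x y p : flat A -> timg i p ->
  lie_bracket (A i x) (A i y) p = A i 0 p.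
Proof.
move=> fA ip.
have := fA i (img i) (cst x) (cst y) (local_field_cst i x) (local_field_cst i y) p ip.
by rewrite /lift_field lie_bracket_cst.
Qed.

Lemma pre_joyce_formally_flat (Om : symplectic_form M) h :
  pre_joyce Om h -> formally_flat h.
Proof.
move=> pj; apply: formally_flatP => i x y p ip.
have Hh z := hlift_holomorphic h i z.
have Hv z : holomorphic (timg i) (vlift i z) by exact: holomorphic_cst.
pose X z := cfield i (h i z); pose Y z := cfield i (vlift i z).
have pe (eps : C) : eps != 0 -> cbracket (X x + eps^-1 *: Y x) (X y + eps^-1 *: Y y) = 0.
  move=> e0; have [fl _] := pj eps e0.
  have Hp z : holomorphic (timg i) (pencil h eps i z).
    exact: (holomorphicD (@open_timg R n M i) (Hh z)
      (holomorphicZ eps^-1 (@open_timg R n M i) (Hv z))).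
  have E z : X z + eps^-1 *: Y z = cfield i (pencil h eps i z).
    apply: hfield_eq => q iq; rewrite cfieldE//.
    by rewrite -[LHS]/(X z q + eps^-1 *: Y z q) !cfieldE.
  apply: hfield_eq => q iq; rewrite !E cbracketE//.
  rewrite (flat_cst x y fl iq) /pencil hlift0// add0r /vlift.
  by congr pair; rewrite /= scaler0.
have vv : cbracket (Y x) (Y y) = 0.
  by apply: hfield_eq => q iq; rewrite cbracketE// lie_bracket_cst.
have p1 := pe 1 (oner_neq0 _); rewrite invr1 !scale1r in p1.
have pm1 := pe (-1); rewrite oppr_eq0 oner_eq0 invrN invr1 !scaleN1r in pm1.
have [E1 E2] := br_pencil (@hbracket_linearl _ _ _ (@open_timg R n M i) tcoordinates)
  (@hbracket_linearr _ _ _ (@open_timg R n M i) tcoordinates) vv p1 (pm1 isT).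
split.
  apply: (etrans (esym (cbracketE (Hh x) (Hh y) ip))).
  exact: (congr1 (fun F => hval F p) E1).
apply: (etrans (congr2 +%R (esym (cbracketE (Hh x) (Hv y) ip))
  (esym (cbracketE (Hv x) (Hh y) ip)))).
exact: (congr1 (fun F => hval F p) E2).
Qed.

Section Torsion.
Variable P : period_structure M.
Let K := nabla P.

Lemma derive_nabla_vertical i p x y : timg i p ->
  'D_(0, y) (K i x) p = (0, (K i x (p.1, y)).2).
Proof.
move=> ip; apply: derive_affine => s.
have E q : timg i q -> K i x q = (x, (K i x q).2).
  by move=> iq; rewrite {1}[K i x q]surjective_pairing (hlift_proj K iq).
rewrite E; last by rewrite /timg/= scaler0 add0r.
rewrite (E p ip); congr pair => /=; first by rewrite scaler0 addr0.
have -> : s *: ((0, y) : TE) + p = (p.1, s *: y + p.2).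
  by congr pair; rewrite /= ?scaler0 ?add0r.
rewrite (@nabla_linear R n M P i p.1 ip x s y p.2) addrC; congr (_ + _).
by rewrite -surjective_pairing.
Qed.

(* Z satisfies the equations D_x Z = x + K x Z; equating D_y D_x Z with
   D_x D_y Z along the section Z, the curvature terms cancel by flatness and only
   the torsion remains. *)
Lemma nabla_torsion_free i z x y : img i z -> (K i x (z, y)).2 = (K i y (z, x)).2.
Proof.
move=> iz; set Z := Zfield P i; pose q := ((z, Z z) : TE).
have iq : timg i q by [].
have HZ : holomorphic (img i) Z by have [] := Zfield_vector_field P.
have dZ := holomorphic_differentiable HZ iz.
have E1 v z' : img i z' -> 'D_v Z z' = v + (K i v (z', Z z')).2.
  by move=> iz'; rewrite -[v in v + _](nabla_Zfield P v iz') /covariant subrK.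
(* [phi] is the section Z of TM. As nabla Z = Id, its derivative along v is the horizontal lift of v
   plus the vertical vector v. *)
pose phi z' : TE := (z', Z z').
have dphi : differentiable phi z by exact: differentiable_pair.
have Dphi v : 'D_v phi z = K i v q + (0, v).
  apply: (etrans (derive_pair v (ex_diff (is_diff_def := is_diff_id z)) dZ)).
  rewrite derive_id (E1 v z iz) [K i v q]surjective_pairing (hlift_proj K iq).
  by congr pair => /=; [rewrite addr0|rewrite addrC].
have dK v : differentiable (K i v) q.
  exact: (holomorphic_differentiable (hlift_holomorphic K i v) iq).
have E2 v w : 'D_w (fun z' => 'D_v Z z') z =
    ('D_(K i w q) (K i v) q).2 + (K i v (z, w)).2.
  have dKphi := differentiable_comp dphi (dK v).
  rewrite (eq_open_derive w (@img_open R n M i) (E1 v) iz).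
  have -> : 'D_w (fun z' => v + (K i v (z', Z z')).2) z =
      'D_w (tsnd \o (K i v \o phi)) z.
    rewrite -[LHS]/('D_w (cst v + (tsnd \o (K i v \o phi))) z) deriveD.
    - by rewrite derive_cst add0r.
    - exact: derivable_cst.
    - apply: diff_derivable; apply: differentiable_comp dKphi _.
      by apply: linear_differentiable; exact: continuous_tsnd.
  rewrite (derive_linear_comp w continuous_tsnd dKphi).
  rewrite (derive_comp w dphi (dK v)) Dphi (derive_dirD _ _ (dK v)).
  by rewrite derive_nabla_vertical.
have S := etrans (esym (E2 x y)) (etrans
  (derive_derive_sym (@img_open R n M i) ecoordinates y x HZ iz) (E2 y x)).
have fl : 'D_(K i y q) (K i x) q = 'D_(K i x q) (K i y) q.
  apply/eqP; rewrite -subr_eq0; apply/eqP.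
  exact: (etrans (flat_cst y x (nabla_flat P) iq) (hlift0 K iq)).
apply: (addrI ('D_(K i y q) (K i x) q).2); apply: (etrans S).
exact: (congr1 (fun A : TE => A.2 + (K i y (z, x)).2) (esym fl)).
Qed.

Lemma nabla_formally_flat : formally_flat K.
Proof.
apply: formally_flatP => i x y p ip; split.
  by rewrite (flat_cst x y (nabla_flat P) ip) hlift0.
(* Order -1: vertical lifts are constant, so only vertical derivatives of the lifts of nabla remain,
   and their difference is the torsion. *)
rewrite /lie_bracket.
have -> : 'D_(K i x p) (vlift i y) p = 0 by exact: derive_cst.
have -> : 'D_(K i y p) (vlift i x) p = 0 by exact: derive_cst.
rewrite sub0r subr0 /vlift !derive_nabla_vertical//.
by rewrite nabla_torsion_free// addNr.
Qed.

End Torsion.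

End FlatConnections.

(** * The gauge transformation *)

Section GaugeStep.
Context {R : realType} {n : nat} (M : complex_manifold R n).
Local Notation C := (Cplx R).
Local Notation E := ('rV[C]_n).
Local Notation TE := (E * E)%type.
Local Notation series := (nat -> chart_index M -> TE -> TE).
Implicit Types (i j : chart_index M) (p : TE) (g : series).

Variables (H h : connection M).

Definition gser g i k := cfield i (g k i).

Definition gexp g i l := exps (@cbracket R n M i) (gser g i) (cseries H i l).

(** Index m stands for order m - 1, so this is agreement up to eps^(k-1), and [residual g k] is the
    discrepancy in order eps^k. *)
Definition matches k g := forall i l m, (m <= k)%N -> gexp g i l m = cseries h i l m.

Definition residual g k i l : hfield (@open_timg R n M i) :=
  gexp g i l k.+1 - cseries h i l k.+1.

Lemma gauge_algebra_holomorphic g i k : gauge_algebra g -> (0 < k)%N ->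
  holomorphic (timg i) (g k i).
Proof. by move=> Hg k0; have [] := Hg k k0. Qed.

Lemma gexpE g i l m p : gauge_algebra g -> timg i p -> gexp g i l m p =
  exp_ad_series (fun k => g k i) (formal_connection H i (cst (ebase l))) m p.
Proof.
move=> Hg ip; apply: esym.
apply: (exp_ad_series_hfield (Uo := @open_timg R n M i) tcoordinates) => //.
  move=> k q k0 iq; apply: esym; apply: cfieldE => //.
  exact: gauge_algebra_holomorphic.
move=> k q iq; apply: esym; apply: cfieldE => //.
exact: holomorphic_formal_cst.
Qed.

Lemma cseriesE (h' : connection M) i l m p : timg i p ->
  cseries h' i l m p = formal_connection h' i (cst (ebase l)) m p.
Proof. by move=> ip; apply: cfieldE => //; exact: holomorphic_formal_cst. Qed.

(** Index 0 is [v] for every connection, and a gauge series starts too late to change it. *)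
Lemma matches0 g : matches 0 g.
Proof.
move=> i l [|//] _; rewrite /gexp /exps big_ord_recl big_ord0 addr0.
by rewrite fact0 invr1 scale1r.
Qed.

Lemma residual_vertical g k i l p : gauge_algebra g -> timg i p ->
  (residual g k i l p).1 = 0.
Proof.
move=> Hg ip.
rewrite -[LHS]/((gexp g i l k.+1 p - cseries h i l k.+1 p).1).
rewrite gexpE// cseriesE//.
(* The base part common to both connections: the lifted vector in index 1, and 0 in every other
   index. *)
pose w m : E := if m is 1 then ebase l else 0.
have wE (h' : connection M) m q : timg i q ->
    (formal_connection h' i (cst (ebase l)) m q).1 = w m.
  by case: m => [|[|m]] iq //=; rewrite /lift_field; exact: hlift_proj.
have gv k' q : (0 < k')%N -> timg i q -> tfst (g k' i q) = 0.
  by move=> k'0 iq; have [_ + _] := Hg k' k'0; apply.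
have L := @linear_exp_ad_series R TE (timg i) (@open_timg R n M i) tcoordinates E tfst
  (fun k => g k i) (formal_connection H i (cst (ebase l))) w continuous_tfst
  (fun k k0 => @gauge_algebra_holomorphic g i k Hg k0)
  (holomorphic_formal_cst H i (ebase l)) gv (wE H) k.+1 p ip.
have -> : (exp_ad_series (fun k => g k i) (formal_connection H i (cst (ebase l))) k.+1 p -
    formal_connection h i (cst (ebase l)) k.+1 p).1 =
  tfst (exp_ad_series (fun k => g k i) (formal_connection H i (cst (ebase l))) k.+1 p) -
   (formal_connection h i (cst (ebase l)) k.+1 p).1 by [].
by rewrite L wE// subrr.
Qed.

Lemma residual_closed g k i l l' p : formally_flat H -> formally_flat h ->
  matches k g -> timg i p ->
  'D_(tbase (inr l)) (residual g k i l') p = 'D_(tbase (inr l')) (residual g k i l) p.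
Proof.
move=> FH Fh mg ip.
have bl := @hbracket_linearl _ _ _ (@open_timg R n M i) tcoordinates.
have br := @hbracket_linearr _ _ _ (@open_timg R n M i) tcoordinates.
have ba := @hbracket_anti _ _ _ (@open_timg R n M i) tcoordinates.
have bj := @hbracket_jacobi _ _ _ (@open_timg R n M i) tcoordinates.
have E0 a : gexp g i a 0 = cseries h i a 0 by exact: mg.
have := sbr_first_difference bl br (mg i l) (mg i l')
  (etrans (exps_commute bl br ba bj (gser g i) (FH i l l') k.+1) (esym (Fh i l l' k.+1))).
rewrite !E0 -/(residual g k i l') -/(residual g k i l) => S.
(* The coefficients of index 0 are constant vertical fields, so their brackets with residuals reduce
   to fibre derivatives. *)
have {}S : lie_bracket (cst (tbase (inr l))) (residual g k i l') p +
   lie_bracket (residual g k i l) (cst (tbase (inr l'))) p = 0.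
  have S' := congr1 (fun F => hval F p) S.
  have v0 a q : timg i q -> cst (tbase (inr a)) q = cseries h i a 0 q.
    by move=> iq; apply: esym; exact: (cseriesE h a 0 iq).
  apply: (etrans _ S'); apply: (congr2 +%R).
    apply: (etrans _ (esym (hbracketE tcoordinates _ _ ip))).
    exact: (eq_lie_bracket (@open_timg R n M i) (v0 l) (fun _ _ => erefl) ip).
  apply: (etrans _ (esym (hbracketE tcoordinates _ _ ip))).
  exact: (eq_lie_bracket (@open_timg R n M i) (fun _ _ => erefl) (v0 l') ip).
move: S; rewrite /lie_bracket !derive_cst subr0 sub0r => /eqP.
by rewrite subr_eq0 => /eqP.
Qed.

(** Tensoriality of the discrepancy. The coefficients are Jacobian entries, functions on M which
    vertical fields annihilate, so they pass through the exponential. *)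
Lemma residual_compat g k i j a p : gauge_algebra g -> overlap i j p.1 ->
  'D_(residual g k i a p) (Ttau i j) p =
  \sum_l ecoord l ('D_(ebase a) (tau i j) p.1) *: residual g k j l (Ttau i j p).
Proof.
move=> Hg op; have ip : timg i p := overlap_img op.
have jp : timg j (Ttau i j p) := overlap_tau op.
have dT := holomorphic_differentiable (@holomorphic_Ttau R n M i j) (op : tover i j p).
rewrite -[residual g k i a p]/(gexp g i a k.+1 p - cseries h i a k.+1 p).
rewrite (derive_dirB _ _ dT) gexpE// cseriesE// formal_connection_compat//.
pose c (l : 'I_n) (q : TE) := ecoord l ('D_(ebase a) (tau i j) q.1).
have Hc l : holomorphic (tover i j) (c l).
  exact: (@holomorphic_basic R n C (overlap i j)
    (fun z => ecoord l ('D_(ebase a) (tau i j) z)) (@open_overlap R n M i j)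
    (holomorphic_ccoord (B := ecoordinates) l (@open_overlap R n M i j)
      (holomorphic_derive (ebase a) (@transition_holomorphic R n M i j)))).
have oi : tover i j `<=` timg i by move=> q; exact: overlap_img.
have E1 : 'D_(exp_ad_series (fun k => g k i) (formal_connection H i (cst (ebase a))) k.+1 p)
    (Ttau i j) p = \sum_l c l p *:
    exp_ad_series (fun k => g k j) (formal_connection H j (cst (ebase l))) k.+1 (Ttau i j p).
  apply: (@exp_ad_series_related R TE TE tcoordinates tcoordinates
     (tover i j) (@open_tover R n M i j) (timg j) (@open_timg R n M j) _ (Ttau i j)
     (fun k => g k i) (formal_connection H i (cst (ebase a)))
     (fun k => g k j) (fun l => formal_connection H j (cst (ebase l))) c).
  - by move=> q; exact: overlap_tau.
  - exact: holomorphic_Ttau.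
  - move=> k' k'0; apply: holomorphic_sub oi _.
    exact: gauge_algebra_holomorphic.
  - by move=> m; apply: holomorphic_sub oi _; exact: holomorphic_formal_cst.
  - by move=> k' k'0; exact: gauge_algebra_holomorphic.
  - by move=> l m; exact: holomorphic_formal_cst.
  - move=> k' l q k'0 oq; split; first exact: holomorphic_differentiable (Hc l) oq.
    apply: derive_affine => s; rewrite scaler0 addr0 /c.
    have [_ v _] := Hg k' k'0.
    have -> : (s *: g k' i q + q).1 = s *: (g k' i q).1 + q.1 by [].
    by rewrite v ?scaler0 ?add0r//; exact: overlap_img oq.
  - by move=> k' q k'0 oq; have [_ _ +] := Hg k' k'0; apply.
  - by move=> m q oq; exact: formal_connection_compat.
  - exact: op.
rewrite E1 -sumrB; apply: eq_bigr => l _.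
rewrite -[residual g k j l _]/(gexp g j l k.+1 (Ttau i j p) - cseries h j l k.+1 (Ttau i j p)).
by rewrite gexpE// cseriesE// scalerBr.
Qed.

End GaugeStep.

Section GaugeExistence.
Context {R : realType} {n : nat} (M : complex_manifold R n).
Local Notation C := (Cplx R).
Local Notation E := ('rV[C]_n).
Local Notation TE := (E * E)%type.
Local Notation series := (nat -> chart_index M -> TE -> TE).
Implicit Types (i j : chart_index M) (p : TE) (g : series).

Variables (H h : connection M).
Hypotheses (H_flat : formally_flat H) (h_flat : formally_flat h).

(** For each fixed fibre component [c], a scalar 1-form along the fibres with index [l]; closedness
    and primitives are taken one component at a time. *)
Let res g k i c l : TE -> C := fun q => tcoord (inr c) (residual H h g k i l q).

Definition correction g k : chart_index M -> TE -> TE :=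
  fun i p => (0, \row_c fibre_primitive (res g k i c) p).

Lemma holomorphic_res g k i c l : holomorphic (timg i) (res g k i c l).
Proof.
exact: (holomorphic_ccoord (B := tcoordinates) (inr c) (@open_timg R n M i)
  (hval_holomorphic (residual H h g k i l))).
Qed.

Lemma tcoord_correction g k i c : (fun p => tcoord c (correction g k i p)) =
  if c is inr b then fibre_primitive (res g k i b) else cst 0.
Proof. by apply/funext => p; case: c => b /=; rewrite mxE. Qed.

Lemma holomorphic_correction g k i : holomorphic (timg i) (correction g k i).
Proof.
apply: (holomorphic_coordinates (B := tcoordinates) (@open_timg R n M i)) => c.
rewrite -[X in holomorphic _ X]/(fun p => tcoord c (correction g k i p)).
rewrite tcoord_correction; case: c => c; first exact: holomorphic_cst.
exact: (holomorphic_fibre_primitive (@img_open R n M i) (holomorphic_res g k i c)).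
Qed.

Lemma derive_correction g k i m p : gauge_algebra g -> matches H h k g ->
  timg i p -> 'D_(tbase (inr m)) (correction g k i) p = residual H h g k i m p.
Proof.
move=> Hg mg ip; apply: (ccoord_inj (B := tcoordinates)) => c.
have dc := holomorphic_differentiable (@holomorphic_correction g k i) ip.
apply: (etrans (esym (derive_linear_comp (tbase (inr m))
  (continuous_ccoord (c := tcoordinates) (i := c)) dc))).
rewrite -[X in 'D__ X p = _]/(fun p => tcoord c (correction g k i p)).
rewrite -[RHS]/(tcoord c (residual H h g k i m p)) tcoord_correction.
case: c => b.
  by rewrite derive_cst /tcoord residual_vertical// mxE.
have closed l l' q : timg i q ->
    'D_(tbase (inr l)) (res g k i b l') q = 'D_(tbase (inr l')) (res g k i b l) q.
  move=> iq.
  have D a a' : 'D_(tbase (inr a)) (res g k i b a') q =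
      tcoord (inr b) ('D_(tbase (inr a)) (residual H h g k i a') q).
    exact: (derive_linear_comp (tbase (inr a))
     (continuous_ccoord (c := tcoordinates) (i := inr b))
     (holomorphic_differentiable (hval_holomorphic (residual H h g k i a')) iq)).
  apply: (etrans (D l l')); apply: (etrans _ (esym (D l' l))).
  exact: (congr1 (tcoord (inr b)) (@residual_closed R n M H h g k i l l' q H_flat h_flat mg iq)).
exact: (@derive_fibre_primitive R n (img i) (@img_open R n M i) (res g k i b) p m
  (holomorphic_res g k i b) closed ip).
Qed.

(** The coefficients do not depend on t, so they move under the integral, and residuals in two
    charts can be compared point by point along a ray. *)
Lemma sum_fint (J : finType) i (A : J -> C) (f : J -> TE -> C) p :
  (forall l, holomorphic (timg i) (f l)) -> timg i p ->
  \sum_l A l * fint 0 (f l) p =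
  cint (fun t => \sum_l A l * (of_real t ^+ 0 * f l (fscale t p))).
Proof.
move=> Hf ip; have fc l := continuous_fint (a := 0) (Hf l) ip.
have Ac l : continuous (fun t => A l * (of_real t ^+ 0 * f l (fscale t p))).
  by move=> t; apply: cvgM; [exact: cvg_cst|exact: fc].
by rewrite (cint_sum Ac); apply: eq_bigr => l _; rewrite (cintZ _ (fc l)).
Qed.

(** The Jacobian entries [A a b] depend on the base point alone, hence are constant along the ray
    through [p]. [K] is the transformation rule of the residual along that ray, integrated over t;
    contraction with the fibre coordinates of [p] then gives the rule for the primitive. *)
Lemma correction_compat g k i j p : gauge_algebra g -> overlap i j p.1 ->
  'D_(correction g k i p) (Ttau i j) p = correction g k j (Ttau i j p).
Proof.
move=> Hg op; have ip : timg i p := overlap_img op.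
have jp : timg j (Ttau i j p) := overlap_tau op.
have dt := differentiable_tau op.
pose A a b : C := ecoord b ('D_(ebase a) (tau i j) p.1).
have DA y b : ecoord b ('D_y (tau i j) p.1) = \sum_a ecoord a y * A a b.
  rewrite (derive_cbase ecoordinates _ dt) linear_sum.
  by apply: eq_bigr => a _; rewrite linearZ.
have K a b : \sum_l A a l * fint 0 (res g k j b l) (Ttau i j p) =
    \sum_c A c b * fint 0 (res g k i c a) p.
  apply: (etrans (@sum_fint _ j (A a) (res g k j b) _ (holomorphic_res g k j b) jp)).
  apply: (etrans _ (esym (@sum_fint _ i (fun c => A c b) (fun c => res g k i c a) p
    (fun c => holomorphic_res g k i c a) ip))).
  apply: (congr1 cint); apply/funext => t.
  have ot : overlap i j (fscale t p).1 := op.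
  have it : timg i (fscale t p) := ip.
  have S := @residual_compat R n M H h g k i j a (fscale t p) Hg ot.
  have E1 : ecoord b (tsnd ('D_(residual H h g k i a (fscale t p)) (Ttau i j) (fscale t p))) =
      \sum_c res g k i c a (fscale t p) * A c b.
    rewrite [residual H h g k i a (fscale t p)]surjective_pairing.
    rewrite (@residual_vertical R n M H h g k i a (fscale t p) Hg it) (derive_Ttau_vertical _ ot).
    exact: (DA (residual H h g k i a (fscale t p)).2 b).
  have E2 : ecoord b (tsnd (\sum_l ecoord l ('D_(ebase a) (tau i j) (fscale t p).1) *:
      residual H h g k j l (Ttau i j (fscale t p)))) =
      \sum_l A a l * res g k j b l (fscale t (Ttau i j p)).
    rewrite !linear_sum; apply: eq_bigr => l _.
    by rewrite !linearZ (Ttau_fscale t op).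
  rewrite S E2 in E1.
  under eq_bigr => l _ do rewrite expr0 mul1r.
  rewrite E1; apply: eq_bigr => c _.
  by rewrite expr0 mul1r mulrC.
rewrite (derive_Ttau_vertical _ op); apply: (congr1 (pair 0)); apply/rowP => b.
rewrite [RHS]mxE; apply: (etrans (DA _ b)).
have E1 c : ecoord c (\row_c fibre_primitive (res g k i c) p) =
    \sum_a p.2 0 a * fint 0 (res g k i c a) p by rewrite /ecoord mxE.
have E2 : fibre_primitive (res g k j b) (Ttau i j p) =
    \sum_l (\sum_a p.2 0 a * A a l) * fint 0 (res g k j b l) (Ttau i j p).
  by apply: eq_bigr => l _; congr (_ * _); exact: (DA p.2 l).
rewrite E2; under eq_bigr => c _ do rewrite E1 mulr_suml.
under [RHS]eq_bigr => l _ do rewrite mulr_suml.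
rewrite exchange_big [RHS]exchange_big; apply: eq_bigr => a _.
under [RHS]eq_bigr => l _ do rewrite -mulrA.
rewrite -mulr_sumr K mulr_sumr; apply: eq_bigr => c _.
by rewrite -mulrA [_ * A c b]mulrC.
Qed.

End GaugeExistence.

(** * Construction and uniqueness of the gauge series *)

Section GaugeTheorem.
Context {R : realType} {n : nat} (M : complex_manifold R n).
Local Notation C := (Cplx R).
Local Notation E := ('rV[C]_n).
Local Notation TE := (E * E)%type.
Local Notation series := (nat -> chart_index M -> TE -> TE).
Implicit Types (i j : chart_index M) (p : TE) (g : series).

Variables (H h : connection M).
Hypotheses (H_flat : formally_flat H) (h_flat : formally_flat h).

Lemma eq_gser_matches k g g' : (forall a, (0 < a <= k)%N -> g a = g' a) ->
  matches H h k g -> matches H h k g'.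
Proof.
move=> gg' mg i l m mk; rewrite -(mg i l m mk).
apply: esym; apply: (@exps_ext _ _ (@cbracket R n M i) (gser g i) (gser g' i) _ k) => //.
by move=> j jk; rewrite /gser gg'.
Qed.

Lemma vertical_bracket i (f : hfield (@open_timg R n M i)) l p : timg i p ->
  cbracket f (cseries h i l 0) p = - 'D_(tbase (inr l)) f p.
Proof.
move=> ip; apply: (etrans (hbracketE tcoordinates _ _ ip)).
have E q : timg i q -> cseries h i l 0 q = cst (tbase (inr l)) q.
  by move=> iq; exact: (cseriesE h l 0 iq).
apply: (etrans (eq_lie_bracket (@open_timg R n M i) (fun _ _ => erefl) E ip)).
by rewrite /lie_bracket derive_cst sub0r.
Qed.

Definition extend k g : series :=
  fun m => if m == k.+1 then correction H h g k else g m.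

Lemma gauge_algebra_extend k g : gauge_algebra g -> gauge_algebra (extend k g).
Proof.
move=> Hg m m0; rewrite /extend; case: eqP => _; last exact: Hg.
split=> [i|i p _|i j p op]; first exact: holomorphic_correction.
  by [].
exact: correction_compat.
Qed.

Lemma matches_extend k g : gauge_algebra g -> g k.+1 = (fun _ _ => 0) ->
  matches H h k g -> matches H h k.+1 (extend k g).
Proof.
move=> Hg gk0 mg i l m; rewrite leq_eqVlt => /predU1P[->|]; last first.
  rewrite ltnS => mk.
  have me : matches H h k (extend k g).
    apply: eq_gser_matches mg => j /andP[_ jk].
    by rewrite /extend ltn_eqF// ltnS.
  exact: me.
have bl := @hbracket_linearl _ _ _ (@open_timg R n M i) tcoordinates.
have br := @hbracket_linearr _ _ _ (@open_timg R n M i) tcoordinates.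
have gg' (j : nat) : (0 < j <= k)%N -> gser (extend k g) i j = gser g i j.
  by move=> /andP[_ jk]; rewrite /gser /extend ltn_eqF// ltnS.
have S := exps_step bl br (cseries H i l) gg'.
have ext1 : gser (extend k g) i k.+1 = cfield i (correction H h g k i).
  by rewrite /gser /extend eqxx.
have g0 : gser g i k.+1 = 0.
  apply: hfield_eq => p ip; rewrite /gser gk0 cfieldE//.
  exact: holomorphic_cst.
(* After subtracting the old value, [exps_step] leaves the bracket of the correction with v_l, which
   has to be minus the residual. *)
apply: (addIr (- gexp H g i l k.+1)); apply: (etrans S).
rewrite ext1 g0 subr0.
rewrite -[RHS]opprK opprB.
rewrite -/(residual H h g k i l).
apply: hfield_eq => p ip.
rewrite -[RHS]/(- residual H h g k i l p).
apply: (etrans (vertical_bracket (cfield i (correction H h g k i)) l ip)).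
congr (- _).
rewrite -(derive_correction H_flat h_flat l Hg mg ip).
apply: (eq_open_derive _ (@open_timg R n M i) _ ip) => q iq.
by rewrite cfieldE//; exact: holomorphic_correction.
Qed.

Fixpoint approx k : series :=
  if k is k'.+1 then extend k' (approx k') else fun _ _ _ => 0.

Lemma approx_spec k : [/\ gauge_algebra (approx k),
  forall m, (k < m)%N -> approx k m = (fun _ _ => 0) &
  matches H h k (approx k)].
Proof.
elim: k => [|k [Hg g0 mg]].
  split=> // [m _|]; last exact: matches0.
  split=> [i|//|i j p op]; first exact: holomorphic_cst.
  exact: derive0.
split=> [|m km|] /=; first exact: gauge_algebra_extend.
  by rewrite /extend gtn_eqF// g0// ltnW.
by apply: matches_extend => //; exact: g0.
Qed.

Lemma approx_stable k m : (m <= k)%N -> approx k m = approx m m.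
Proof.
elim: k => [|k IH]; first by rewrite leqn0 => /eqP ->.
rewrite leq_eqVlt => /predU1P[->//|mk]; rewrite /= {1}/extend ltn_eqF//.
exact: IH.
Qed.

(** The diagonal of the approximations: the coefficient of index m is set at stage m and left alone
    by all later stages. *)
Definition gauge_solution : series := fun m => approx m m.

Lemma gauge_solution_algebra : gauge_algebra gauge_solution.
Proof. by move=> k k0; have [Hg _ _] := approx_spec k; exact: Hg. Qed.

Lemma gauge_solution_matches k : matches H h k gauge_solution.
Proof.
have [_ _ mg] := approx_spec k; apply: eq_gser_matches mg => j /andP[_ jk].
exact: approx_stable.
Qed.

Lemma gauge_solution_vanishes : vanishes_on_zero_section gauge_solution.
Proof.
move=> [//|k] i z _ iz; rewrite /gauge_solution /= /extend eqxx /correction.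
by congr pair; apply/rowP => c; rewrite !mxE fibre_primitive0.
Qed.

(** Passes from the coordinate frame to an arbitrary local field: the components of X are functions
    on M, constant along vertical fields, so they factor out of the exponential. *)
Lemma matches_relates g : gauge_algebra g -> (forall k, matches H h k g) ->
  gauge_relates g H h.
Proof.
move=> Hg mg i A X HX m p Ap; have [Ao Ai HX'] := HX.
have ip : timg i p := Ai _ Ap.
pose U := [set q : TE | A q.1].
have Uo : open U by exact: (@open_fibres R n A Ao).
pose c (l : 'I_n) (q : TE) := ecoord l (X q.1).
have Hc l : holomorphic U (c l).
  exact: (@holomorphic_basic R n C A (fun z => ecoord l (X z)) Ao
    (holomorphic_ccoord (B := ecoordinates) l Ao HX')).
have Ui : U `<=` timg i by move=> q; exact: Ai.
have S : 'D_(exp_ad_series (fun k => g k i) (formal_connection H i X) m p) id p =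
    \sum_l c l p *:
    exp_ad_series (fun k => g k i) (formal_connection H i (cst (ebase l))) m (id p).
  apply: (@exp_ad_series_related R TE TE tcoordinates tcoordinates
     U Uo (timg i) (@open_timg R n M i) _ id
     (fun k => g k i) (formal_connection H i X)
     (fun k => g k i) (fun l => formal_connection H i (cst (ebase l))) c).
  - by move=> q; exact: Ai.
  - exact: holomorphic_id.
  - move=> k k0; apply: holomorphic_sub Ui _.
    exact: gauge_algebra_holomorphic.
  - by move=> m'; exact: holomorphic_formal.
  - by move=> k k0; exact: gauge_algebra_holomorphic.
  - by move=> l m'; exact: holomorphic_formal_cst.
  - move=> k l q k0 Uq; split; first exact: holomorphic_differentiable (Hc l) Uq.
    apply: derive_affine => s; rewrite scaler0 addr0 /c.
    have [_ v _] := Hg k k0.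
    have -> : (s *: g k i q + q).1 = s *: (g k i q).1 + q.1 by [].
    by rewrite v ?scaler0 ?add0r//; exact: Ui.
  - by move=> k q k0 Uq; rewrite derive_id.
  - by move=> m' q Uq; rewrite derive_id; apply: formal_connection_sum; exact: Ui.
  - exact: Ap.
rewrite derive_id in S; apply: (etrans S).
apply: (etrans _ (esym (formal_connection_sum h X m ip))).
apply: eq_bigr => l _; congr (_ *: _).
rewrite -(gexpE H l m Hg ip) (mg m i l m (leqnn m)).
exact: cseriesE.
Qed.

Lemma relates_matches g : gauge_algebra g -> gauge_relates g H h ->
  forall k, matches H h k g.
Proof.
move=> Hg rg k i l m _; apply: hfield_eq => p ip.
rewrite (gexpE H l m Hg ip) (cseriesE h l m ip).
exact: (rg i (img i) (cst (ebase l)) (local_field_cst i (ebase l))).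
Qed.

Lemma gauge_solution_unique g g' : gauge_algebra g -> gauge_algebra g' ->
  (forall k, matches H h k g) -> (forall k, matches H h k g') ->
  vanishes_on_zero_section g -> vanishes_on_zero_section g' -> gauge_eq g g'.
Proof.
move=> Hg Hg' mg mg' vg vg'.
suff gs k i : forall j : nat, (0 < j <= k)%N -> gser g i j = gser g' i j.
  move=> k i p k0 ip; have := gs k i k; rewrite k0 leqnn => /(_ isT) E.
  have Ep := congr1 (fun F => hval F p) E.
  apply: (etrans (esym (cfieldE (gauge_algebra_holomorphic i Hg k0) ip))).
  exact: (etrans Ep (cfieldE (gauge_algebra_holomorphic i Hg' k0) ip)).
elim: k => [|k IH] j /andP[j0 jk]; first by move: j0; rewrite (eqP (_ : j == 0%N)) -?leqn0.
move: jk; rewrite leq_eqVlt => /predU1P[->|]; last first.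
  by rewrite ltnS => jk; apply: IH; rewrite j0 jk.
have bl := @hbracket_linearl _ _ _ (@open_timg R n M i) tcoordinates.
have br := @hbracket_linearr _ _ _ (@open_timg R n M i) tcoordinates.
pose D := gser g i k.+1 - gser g' i k.+1.
(* Both exponentials have the same coefficient of index k + 1 while [g] and [g'] agree up to index
   k, so [exps_step] turns the equality into a vanishing bracket. *)
have D0 l : cbracket D (cseries H i l 0) = 0.
  have S := exps_step bl br (cseries H i l) IH.
  apply: (etrans (esym S)).
  rewrite -[X in X - _]/(gexp H g i l k.+1) -[X in _ - X]/(gexp H g' i l k.+1).
  by rewrite (mg k.+1) ?(mg' k.+1)// subrr.
have H0 l : cseries H i l 0 = cseries h i l 0 by [].
have dD l p : timg i p -> 'D_(tbase (inr l)) D p = 0.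
  move=> ip; apply: oppr_inj; rewrite -(vertical_bracket D l ip) -H0 D0 oppr0.
  by [].
have HD := hval_holomorphic D.
have gE p : timg i p -> D p = g k.+1 i p - g' k.+1 i p.
  move=> ip; rewrite -[LHS]/(gser g i k.+1 p - gser g' i k.+1 p).
  by rewrite !cfieldE//; exact: gauge_algebra_holomorphic.
suff Dz p : timg i p -> D p = 0.
  apply/eqP; rewrite -subr_eq0; apply/eqP; apply: hfield_eq => p ip.
  exact: Dz.
move=> ip; apply: (ccoord_inj (B := tcoordinates)) => c.
have Hc := holomorphic_ccoord (B := tcoordinates) c (@open_timg R n M i) HD.
apply: (etrans _ (esym (linear0 (ccoord (c := tcoordinates) c)))).
apply: (@fibre_constant R n (img i) _ Hc _ _ p ip).
  move=> q l iq.
  apply: (etrans (derive_linear_comp (tbase (inr l))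
    (continuous_ccoord (c := tcoordinates) (i := c))
    (holomorphic_differentiable HD iq))).
  by rewrite dD// linear0.
move=> z iz; rewrite gE// vg// vg'// subrr.
exact: linear0.
Qed.

End GaugeTheorem.

Theorem theorem3p4 (R : realType) (n : nat) (M : complex_manifold R n)
    (J : joyce_structure M) :
  exists g : nat -> chart_index M -> 'rV[Cplx R]_n * 'rV[Cplx R]_n ->
             'rV[Cplx R]_n * 'rV[Cplx R]_n,
    [/\ gauge_algebra g,
        gauge_relates g (nabla (jperiod J)) (jconn J),
        vanishes_on_zero_section g &
        forall g', gauge_algebra g' ->
          gauge_relates g' (nabla (jperiod J)) (jconn J) ->
          vanishes_on_zero_section g' -> gauge_eq g' g].
Proof.
have HF := nabla_formally_flat (jperiod J).
have hF := pre_joyce_formally_flat (joyce_pre J).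
have Hg := gauge_solution_algebra HF hF.
have mg := gauge_solution_matches HF hF.
exists (gauge_solution (nabla (jperiod J)) (jconn J)); split=> //.
- exact: matches_relates.
- exact: gauge_solution_vanishes.
move=> g' Hg' rg' vg'.
apply: (gauge_solution_unique Hg' Hg (relates_matches Hg' rg') mg vg').
exact: gauge_solution_vanishes.
Qed.
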